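(* The Maximum Connectivity Improvement (MCI) problem on DAGs is fixed-parameter tractable with respect to $|V|-B$.
   Context: For a directed graph $G=(V,E)$ let $f(G)$ be the number of ordered pairs $(v,u)\in V\times V$ such that there is a directed path from $v$ to $u$ in $G$ (each vertex reaches itself). For a set $N$ of ordered pairs, $G(N)=(V,E\cup N)$. MCI: given a DAG $G=(V,E)$ and an integer $B\ge 0$, find $N\subseteq (V\times V)\setminus E$ with $|N|\le B$ maximizing $f(G(N))$. FPT with respect to a parameter $k$ means solvable exactly in time $g(k)\cdot |V|^{O(1)}$ for some computable $g$. *)

(* Defs.v *)
From mathcomp Require Import all_boot.

Set Implicit Arguments.
Unset Strict Implicit.
Unset Printing Implicit Defensive.

(* Machine model: a structured random access machine.  A program uses finitely
   many arrays of natural numbers; [a] in [Read a i] and [Write a i e] is the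
   fixed name of an array, [i] a computed index.  The only arithmetic operations
   are addition and truncated subtraction, each at unit cost: unit-cost
   multiplication is deliberately absent, since it would let a machine build
   numbers of exponential length, and running times would no longer be
   polynomially related to those of Turing machines. *)

Inductive expr : Type :=
| Const (c : nat)
| Read (a : nat) (i : expr)
| Add (e1 e2 : expr)
| Sub (e1 e2 : expr).

Inductive cmd : Type :=
| Skip
| Write (a : nat) (i e : expr)
| Seq (c1 c2 : cmd)
| If (e : expr) (c1 c2 : cmd)
| While (e : expr) (c : cmd).

Definition store : Type := nat -> nat -> nat.

Definition update (s : store) (a i v : nat) : store :=
  fun b j => if (b == a) && (j == i) then v else s b j.

Fixpoint eval (s : store) (e : expr) : nat :=
  match e with
  | Const c => c
  | Read a i => s a (eval s i)
  | Add e1 e2 => eval s e1 + eval s e2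
  | Sub e1 e2 => eval s e1 - eval s e2
  end.

Fixpoint eval_time (e : expr) : nat :=
  match e with
  | Const _ => 1
  | Read _ i => (eval_time i).+1
  | Add e1 e2 => (eval_time e1 + eval_time e2).+1
  | Sub e1 e2 => (eval_time e1 + eval_time e2).+1
  end.

(* [exec c s t s']: started in [s], the program [c] halts in [s'] after exactly
   [t] elementary steps.  A test succeeds when its value is nonzero. *)
Inductive exec : cmd -> store -> nat -> store -> Prop :=
| exec_skip s : exec Skip s 1 s
| exec_write a i e s :
    exec (Write a i e) s (eval_time i + eval_time e).+1
         (update s a (eval s i) (eval s e))
| exec_seq c1 c2 s t1 s1 t2 s2 :
    exec c1 s t1 s1 -> exec c2 s1 t2 s2 -> exec (Seq c1 c2) s (t1 + t2) s2
| exec_if_true e c1 c2 s t s' :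
    eval s e != 0 -> exec c1 s t s' ->
    exec (If e c1 c2) s (eval_time e + t).+1 s'
| exec_if_false e c1 c2 s t s' :
    eval s e == 0 -> exec c2 s t s' ->
    exec (If e c1 c2) s (eval_time e + t).+1 s'
| exec_while_true e c s t1 s1 t2 s2 :
    eval s e != 0 -> exec c s t1 s1 -> exec (While e c) s1 t2 s2 ->
    exec (While e c) s (eval_time e + t1 + t2).+1 s2
| exec_while_false e c s :
    eval s e == 0 -> exec (While e c) s (eval_time e).+1 s.

Definition nat_input (k : nat) : store :=
  fun a i => if (a == 0) && (i == 0) then k else 0.

Definition computable (g : nat -> nat) : Prop :=
  exists c : cmd, forall k : nat,
    exists t s', exec c (nat_input k) t s' /\ s' 0 0 = g k.

(* [size x] is the quantity in which the running time must be polynomial; the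
   factor [(size x).+1 ^ d] is [(size x) ^ d] up to a constant, and does not
   vanish on the empty instance. *)
Definition fixed_parameter_tractable (I : Type) (encode : I -> store)
    (solved : I -> store -> Prop) (size param : I -> nat) : Prop :=
  exists (c : cmd) (g : nat -> nat) (d : nat),
    computable g /\
    forall x : I, exists t s',
      [/\ exec c (encode x) t s',
          t <= g (param x) * (size x).+1 ^ d
        & solved x s'].

Section Digraph.

Variable V : finType.
Implicit Types E N : {set V * V}.

Definition arc E : rel V := fun u v => (u, v) \in E.

Definition acyclic E : Prop := forall p : seq V, cycle (arc E) p -> p = [::].

Definition connectivity E : nat :=
  #|[set p : V * V | connect (arc E) p.1 p.2]|.

Definition feasible E (B : nat) N : bool := (N \subset ~: E) && (#|N| <= B).

Definition optimal E (B : nat) N : Prop :=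
  feasible E B N /\
  forall N', feasible E B N' ->
    connectivity (E :|: N') <= connectivity (E :|: N).

End Digraph.

Record mci_instance : Type := MCIInstance {
  nverts : nat;
  arcs : {set 'I_nverts * 'I_nverts};
  arcs_acyclic : acyclic arcs;
  budget : nat
}.

Definition cell (n : nat) (p : 'I_n * 'I_n) : nat := p.1 * n + p.2.

(* Array 0 holds |V| and B, array 1 the adjacency matrix in row-major order. *)
Definition mci_encode (x : mci_instance) : store :=
  fun a i =>
    match a, i with
    | 0, 0 => nverts x
    | 0, 1 => budget x
    | 1, _ => [exists p, (p \in arcs x) && (cell p == i)] : nat
    | _, _ => 0
    end.

(* On halting, array 2 holds the 0/1 matrix of an optimal set of new arcs. *)
Definition mci_solved (x : mci_instance) (s : store) : Prop :=
  exists2 N : {set 'I_(nverts x) * 'I_(nverts x)},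
    optimal (arcs x) (budget x) N & forall p, s 2 (cell p) = (p \in N).

(* Truncated subtraction: all instances with B >= |V| have parameter 0. *)
Definition mci_param (x : mci_instance) : nat := nverts x - budget x.

(* Main.v *)
(* With n = |V| and k = n - B, let S be the set of sinks of the DAG.  A DAG can be
   made strongly connected with max(#sources, #sinks) new arcs: while some source
   does not reach some sink, joining that sink to that source keeps the graph
   acyclic and removes one source and one sink; once all sources reach all sinks,
   arcs from sinks to sources that cover both sides suffice.  Hence if B is at least
   both numbers the optimum is n^2, and otherwise, reversing the arcs if necessary,
   there are fewer than k vertices outside S.

   In that case the sinks fall into at most 2^(k-1) classes of twins (same
   in-neighbours).  Keep 6k vertices of each larger class and chain the other ones
   behind one kept representative, whose new out-arcs are moved to the end of the
   chain.  Some optimum arises in this way from arcs between kept vertices.  Indeed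
   an optimum reaches at least B^2 pairs, so it has a strong component X missing at
   most 4k vertices; swapping twins puts all removed vertices and representatives
   into X.  At least max(#sources, #sinks) of G[X] new arcs lie inside X, which pays
   for the chains together with a strong augmentation of the kept part of X, and the
   new arcs between X and its complement can be redirected to a fixed vertex of X.
   There are at most 2^((k + 6k 2^k)^2) sets of arcs between kept vertices, and they
   are enumerated by a binary counter. *)

From mathcomp Require Import all_boot perm zify.
Require Import Defs.

Set Implicit Arguments.
Unset Strict Implicit.
Unset Printing Implicit Defensive.

(** * Making an acyclic digraph strongly connected *)

(** The delicate point is the budget: a lifted solution may not use more arcs than the optimum that
    it replaces. Removed vertices are sinks, so in an optimum each of them needs a new arc that
    leaves it inside X, and this arc is exchanged for a link of a chain. Counting by sources is
    harder, because a removed vertex need not be a source of G[X]; this is what the quota is for. Of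
    the 6k kept vertices of a class with removed members at most 4k lie outside X, so at least 2k
    lie inside, more than there are non-sinks, and then the sinks of the kept part of X outnumber
    its sources whenever a removed vertex has an in-neighbour in X.

    At run time nothing about the candidates is trusted. The augmentation and the lifted sets of
    both orientations are all tested for feasibility and compared by their connectivity, so only the
    completeness of the list of candidates rests on the analysis. *)

Section Augmentation.

Variable V : finType.
Implicit Types (E N : {set V * V}) (W : {set V}) (a b x y : V).

Lemma acyclic_arc E x y : acyclic E -> (x, y) \in E -> ~~ connect (arc E) y x.
Proof.
move=> acE xy; apply/negP => /connectP[p pp lp].
suff: y :: p = [::] by [].
by apply: acE; rewrite /= rcons_path pp -lp /arc xy.
Qed.

Lemma acyclicI E :
  (forall x y, (x, y) \in E -> ~~ connect (arc E) y x) -> acyclic E.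
Proof.
move=> noback [//|x p] /=; rewrite rcons_path => /andP[pp lx].
case/negP: (noback _ _ lx); apply/connectP; by exists p.
Qed.

Lemma sub_connect_arc E N : E \subset N ->
  subrel (connect (arc E)) (connect (arc N)).
Proof.
move=> sEN; apply: connect_sub => x y xy; apply: connect1.
exact: (subsetP sEN).
Qed.

Lemma acyclic_sub E N : E \subset N -> acyclic N -> acyclic E.
Proof.
move=> sEN acN; apply: acyclicI => x y xy.
apply: contra (acyclic_arc acN (subsetP sEN _ xy)); exact: sub_connect_arc.
Qed.

(** A walk may use the new arc repeatedly; only its part before the first use and its part after the
    last use matter. *)
Lemma connect_add1 E a b x y : connect (arc ((b, a) |: E)) x y ->
  connect (arc E) x y \/ connect (arc E) x b /\ connect (arc E) a y.
Proof.
case/connectP=> p; elim: p x => [|z p IHp] x /= => [_ ->|]; first by left.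
case/andP=> xz pp ly; case: (IHp z pp ly) => [zy|[zb ay]].
  move: xz; rewrite /arc in_setU1 xpair_eqE => /orP[/andP[/eqP-> /eqP za]|xz].
    by right; rewrite -za.
  by left; apply: connect_trans zy; apply: connect1.
move: xz; rewrite /arc in_setU1 xpair_eqE => /orP[/andP[/eqP-> _]|xz].
  by right.
by right; split=> //; apply: connect_trans zb; apply: connect1.
Qed.

Lemma acyclic_add1 E a b :
  acyclic E -> ~~ connect (arc E) a b -> acyclic ((b, a) |: E).
Proof.
move=> acE nab; apply: acyclicI => x y.
rewrite in_setU1 xpair_eqE => /orP[/andP[/eqP-> /eqP->]|xy]; apply/negP.
  by case/connect_add1=> [|[]]; rewrite (negbTE nab).
case/connect_add1 => [|[yb ax]]; first by rewrite (negbTE (acyclic_arc acE xy)).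
case/negP: nab; apply: connect_trans ax _; apply: connect_trans yb.
exact: connect1.
Qed.

(** The second condition ranges over all vertices, not only over those of [W]. For an induced
    subgraph the arcs themselves are intersected with [within W]. *)
Definition sources E W := [set x in W | [forall y, (y, x) \notin E]].
Definition sinks E W := [set x in W | [forall y, (x, y) \notin E]].

Lemma sourcesP E W x :
  reflect (x \in W /\ forall y, (y, x) \notin E) (x \in sources E W).
Proof. by rewrite inE; apply: (iffP andP) => -[-> /forallP]. Qed.

Lemma sinksP E W x :
  reflect (x \in W /\ forall y, (x, y) \notin E) (x \in sinks E W).
Proof. by rewrite inE; apply: (iffP andP) => -[-> /forallP]. Qed.

Lemma sources_add1 E W a b : sources ((b, a) |: E) W = sources E W :\ a.
Proof.
apply/setP=> x; rewrite in_setD1; apply/sourcesP/andP.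
  case=> xW nx; split; first by have:= nx b; rewrite in_setU1 xpair_eqE eqxx; case: eqP.
  by apply/sourcesP; split=> // y; have:= nx y; rewrite in_setU1 negb_or => /andP[].
case=> xa /sourcesP[xW nx]; split=> // y.
by rewrite in_setU1 negb_or nx xpair_eqE (negbTE xa) andbF.
Qed.

Lemma sinks_add1 E W a b : sinks ((b, a) |: E) W = sinks E W :\ b.
Proof.
apply/setP=> x; rewrite in_setD1; apply/sinksP/andP.
  case=> xW nx; split; first by have:= nx a; rewrite in_setU1 xpair_eqE eqxx andbT; case: eqP.
  by apply/sinksP; split=> // y; have:= nx y; rewrite in_setU1 negb_or => /andP[].
case=> xa /sinksP[xW nx]; split=> // y.
by rewrite in_setU1 negb_or nx xpair_eqE (negbTE xa).
Qed.

Definition transpose E : {set V * V} := [set p | (p.2, p.1) \in E].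

Lemma in_transpose E x y : ((x, y) \in transpose E) = ((y, x) \in E).
Proof. by rewrite inE. Qed.

Lemma transposeK : involutive transpose.
Proof. by move=> E; apply/setP=> -[x y]; rewrite !inE. Qed.

Lemma connect_transpose E x y :
  connect (arc (transpose E)) x y = connect (arc E) y x.
Proof.
transitivity (connect [rel u v | arc E v u] x y); last first.
  exact: (connect_rev (arc E) x y).
by apply: eq_connect => u v; rewrite /arc /= in_transpose.
Qed.

Lemma acyclic_transpose E : acyclic E -> acyclic (transpose E).
Proof.
move=> acE; apply: acyclicI => x y; rewrite in_transpose connect_transpose.
exact: acyclic_arc.
Qed.

Lemma sources_transpose E W : sources (transpose E) W = sinks E W.
Proof.
by apply/setP=> x; rewrite !inE; congr (_ && _); apply: eq_forallb => y; rewrite inE.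
Qed.

Definition within W : {set V * V} := [set p | (p.1 \in W) && (p.2 \in W)].

(** In an acyclic graph the set of reachable vertices shrinks strictly along every arc, so following
    arcs must end, and it ends inside [W]. *)
Lemma exists_sink E W x : E \subset within W -> acyclic E -> x \in W ->
  exists2 b, b \in sinks E W & connect (arc E) x b.
Proof.
move=> EW acE; have [m] := ubnP #|[set y | connect (arc E) x y]|.
elim: m x => // m IHm x lem xW; case: (boolP (x \in sinks E W)) => [xs|].
  by exists x.
rewrite inE xW /= => /forallPn[y]; rewrite negbK => xy.
have:= subsetP EW _ xy; rewrite inE => /andP[_ yW].
have [||b bs yb] := IHm y => //; last first.
  by exists b => //; apply: connect_trans yb; apply: connect1.
apply: leq_trans (_ : #|[set y | connect (arc E) x y]| <= m) => //.
apply/proper_card/properP; split.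
  by apply/subsetP=> z; rewrite !inE; apply: connect_trans; apply: connect1.
by exists x; rewrite !inE ?connect0 ?(acyclic_arc acE).
Qed.

Lemma exists_source E W x : E \subset within W -> acyclic E -> x \in W ->
  exists2 a, a \in sources E W & connect (arc E) a x.
Proof.
move=> EW acE xW.
have [|a] := exists_sink _ (acyclic_transpose acE) xW.
  by apply/subsetP=> -[u v]; rewrite in_transpose => /(subsetP EW); rewrite !inE andbC.
rewrite connect_transpose -sources_transpose transposeK; by exists a.
Qed.

(* The hypotheses are the terminal situation of the greedy augmentation. *)
Lemma strong_cover E N W : E \subset within W -> acyclic E ->
  {in sources E W & sinks E W, forall a b, connect (arc E) a b} ->
  {in sinks E W, forall b, exists2 a, a \in sources E W & (b, a) \in N} ->
  {in sources E W, forall a, exists2 b, b \in sinks E W & (b, a) \in N} ->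
  {in W &, forall x y, connect (arc (E :|: N)) x y}.
Proof.
move=> EW acE reach coverb covera x y xW yW.
have lE := sub_connect_arc (subsetUl E N).
have [b bs xb] := exists_sink EW acE xW.
have [a as_ ba] := coverb b bs.
have [a' a's ay] := exists_source EW acE yW.
have [b' b's ba'] := covera a' a's.
apply: connect_trans (lE _ _ xb) _.
apply: (@connect_trans _ _ a); first by apply: connect1; rewrite /arc inE ba orbT.
apply: connect_trans (lE _ _ (reach _ _ as_ b's)) _.
apply: (@connect_trans _ _ a'); first by apply: connect1; rewrite /arc inE ba' orbT.
exact: lE.
Qed.

Lemma strong_augmentation E W : E \subset within W -> acyclic E ->
  exists N, [/\ N \subset within W, N \subset ~: E,
    #|N| <= maxn #|sources E W| #|sinks E W|
    & {in W &, forall x y, connect (arc (E :|: N)) x y}].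
Proof.
have [m] := ubnP #|sources E W|; elim: m E => // m IHm E lem EW acE.
case: (boolP [exists a in sources E W, exists b in sinks E W, ~~ connect (arc E) a b]).
  case/exists_inP=> a as_ /exists_inP[b bs nab].
  have [aW na] := sourcesP _ _ _ as_; have [bW nb] := sinksP _ _ _ bs.
  have := cardsD1 a (sources E W); have := cardsD1 b (sinks E W).
  rewrite as_ bs => csk csr.
  have [|||N [NW NE cN str]] := IHm ((b, a) |: E).
  - by rewrite sources_add1; lia.
  - by rewrite subUset EW andbT; apply/subsetP=> p /set1P->; rewrite inE aW bW.
  - exact: acyclic_add1.
  exists ((b, a) |: N); split.
  - by rewrite subUset NW andbT; apply/subsetP=> p /set1P->; rewrite inE aW bW.
  - rewrite subUset sub1set inE nb /=; apply: subset_trans NE _.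
    by rewrite setCS subsetUr.
  (* The new arc takes one element from each of the two sets, so their maximum drops by one and pays
     for it. *)
  - rewrite cardsU1; move: cN; rewrite sources_add1 sinks_add1; case: (_ \notin _); lia.
  - by move=> x y xW yW; rewrite setUCA setUA; apply: str.
move=> nex; have reach : {in sources E W & sinks E W, forall a b, connect (arc E) a b}.
  move=> a b as_ bs; apply: contraR nex => nab.
  by apply/exists_inP; exists a => //; apply/exists_inP; exists b.
case: (set_0Vmem W) => [W0|[w wW]].
  exists set0; split; rewrite ?sub0set ?cards0 //.
  by move=> x y; rewrite W0 inE.
have [a0 a0s _] := exists_source EW acE wW.
have [b0 b0s _] := exists_sink EW acE wW.
pose A := enum (sources E W); pose B := enum (sinks E W).
have sA : size A = #|sources E W| by rewrite -cardE.
have sB : size B = #|sinks E W| by rewrite -cardE.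
have nA i : nth a0 A i \in sources E W.
  have [lti|lei] := ltnP i (size A); last by rewrite nth_default.
  by rewrite -mem_enum mem_nth.
have nB i : nth b0 B i \in sinks E W.
  have [lti|lei] := ltnP i (size B); last by rewrite nth_default.
  by rewrite -mem_enum mem_nth.
(* Sources and sinks are paired by index. Past the end of the shorter list [nth] returns its
   default, so the surplus of the longer list is joined to [a0] or [b0]. *)
pose N := [set (nth b0 B (val i), nth a0 A (val i)) | i : 'I_(maxn (size A) (size B))].
exists N; split.
- apply/subsetP=> p /imsetP[i _ ->]; rewrite inE /=.
  by have [-> _] := sourcesP _ _ _ (nA i); have [-> _] := sinksP _ _ _ (nB i).
- apply/subsetP=> p /imsetP[i _ ->]; rewrite inE.
  by have [_ ->] := sinksP _ _ _ (nB i).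
- by apply: leq_trans (leq_imset_card _ _) _; rewrite card_ord sA sB.
apply: strong_cover => //.
- move=> b bs; have bB : b \in B by rewrite mem_enum.
  have lti : index b B < maxn (size A) (size B).
    by rewrite leq_max !index_mem bB orbT.
  exists (nth a0 A (index b B)) => //; apply/imsetP; exists (Ordinal lti) => //=.
  by rewrite nth_index.
- move=> a as_; have aA : a \in A by rewrite mem_enum.
  have lti : index a A < maxn (size A) (size B).
    by rewrite leq_max !index_mem aA.
  exists (nth b0 B (index a A)) => //; apply/imsetP; exists (Ordinal lti) => //=.
  by rewrite nth_index.
Qed.

End Augmentation.

(** * Strong components and bounds on connectivity *)

Section StronglyConnected.

Variable V : finType.
Implicit Types (E N : {set V * V}) (X : {set V}) (x y : V).

Lemma sub_connectivity E N :
  (forall x y, connect (arc E) x y -> connect (arc N) x y) ->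
  connectivity E <= connectivity N.
Proof.
by move=> sEN; apply/subset_leq_card/subsetP=> -[x y]; rewrite !inE; apply: sEN.
Qed.

Lemma sub_connect_arcs E N : (forall x y, (x, y) \in E -> connect (arc N) x y) ->
  forall x y, connect (arc E) x y -> connect (arc N) x y.
Proof. by move=> sEN; apply: connect_sub => x y; apply: sEN. Qed.

Lemma card_transpose E : #|transpose E| = #|E|.
Proof.
have inj : injective (@swap_pair V V) := can_inj swap_pairK.
have -> : transpose E = [set swap_pair p | p in E]; last exact: card_imset.
by apply/setP=> -[x y]; rewrite in_transpose -[(x, y)]/(swap_pair (y, x)) mem_imset.
Qed.

Lemma connectivity_transpose E : connectivity (transpose E) = connectivity E.
Proof.
rewrite /connectivity -[RHS]card_transpose; apply: eq_card => -[x y].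
by rewrite !inE connect_transpose.
Qed.

Lemma feasible_transpose E B N :
  feasible (transpose E) B (transpose N) = feasible E B N.
Proof.
rewrite /feasible card_transpose; congr (_ && _).
apply/subsetP/subsetP=> sub [x y]; first by have:= sub (y, x); rewrite !inE.
by have:= sub (y, x); rewrite !inE.
Qed.

Lemma transposeU E N : transpose (E :|: N) = transpose E :|: transpose N.
Proof. by apply/setP=> p; rewrite !inE. Qed.

(** The nonempty sets with this property are the strong components; the empty set has it too. *)
Definition component E X :=
  forall x y, x \in X -> (y \in X) = connect (arc E) x y && connect (arc E) y x.

Lemma component_transpose E X : component E X -> component (transpose E) X.
Proof. by move=> cX x y xX; rewrite !connect_transpose andbC; apply: cX. Qed.

Lemma connect_first E x y : connect (arc E) x y -> x != y ->
  exists2 z, (x, z) \in E & connect (arc E) z y.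
Proof.
case/connectP=> -[|z p] /=; first by move=> _ ->; rewrite eqxx.
by move=> /andP[xz pp] ly _; exists z => //; apply/connectP; exists p.
Qed.

(** A sink of G[X] must still reach another vertex of [X]. The first arc of such a walk stays in
    [X], since its head lies on a closed walk through the sink, and it cannot belong to [E].
    Distinct sinks need distinct arcs. *)
Lemma component_sinks E N X : component (E :|: N) X -> 1 < #|X| ->
  #|sinks (E :&: within X) X| <= #|N :&: within X|.
Proof.
move=> cX X2; apply: leq_trans (leq_imset_card fst _).
apply/subset_leq_card/subsetP=> b /sinksP[bX nb].
have [x xX xb] : exists2 x, x \in X & x != b.
  move: X2; rewrite (cardsD1 b X) bX => X2.
  by have /card_gt0P[x] : 0 < #|X :\ b| by []; rewrite !inE => /andP[xb xX]; exists x.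
have /andP[bx xb'] := etrans (esym (cX b x bX)) xX.
have [|z bz zx] := connect_first bx; first by rewrite eq_sym.
have zX : z \in X.
  rewrite (cX b) // connect1 //=; exact: connect_trans zx xb'.
apply/imsetP; exists (b, z) => //; rewrite !inE bX zX !andbT.
by have:= nb z; move: bz; rewrite !inE bX zX !andbT => /orP[->|].
Qed.

Lemma component_sources E N X : component (E :|: N) X -> 1 < #|X| ->
  #|sources (E :&: within X) X| <= #|N :&: within X|.
Proof.
move=> /component_transpose; rewrite transposeU => cX X2.
have:= component_sinks cX X2.
have -> : sinks (transpose E :&: within X) X = sources (E :&: within X) X.
  rewrite -sources_transpose; congr sources.
  by apply/setP=> -[x y]; rewrite !inE /= [(y \in X) && _]andbC.
move=> /leq_trans; apply; rewrite -card_transpose; apply/subset_leq_card/subsetP.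
by move=> [x y]; rewrite !inE /= => /andP[-> /andP[-> ->]].
Qed.

(** Inclusion-exclusion for the reachability relation and its converse: their union has at most
    |V|^2 pairs, and their intersection consists of the pairs inside one strong component, so it has
    at most |V| times the size of a largest component. *)
Lemma large_component E : 0 < #|V| -> exists X, component E X /\
  2 * connectivity E <= #|V| * #|X| + #|V| ^ 2.
Proof.
move=> V0; pose A := [set p | connect (arc E) p.1 p.2].
pose scc x := [set y | connect (arc E) x y && connect (arc E) y x].
have cS x : component E (scc x).
  move=> u v; rewrite !inE => /andP[xu ux]; apply/andP/andP=> -[].
    by move=> xv vx; split; [apply: connect_trans xv | apply: connect_trans xu].
  by move=> uv vu; split; [apply: connect_trans uv | apply: connect_trans ux].
have AT : #|transpose A| = #|A|.
  have -> : transpose A = [set p | connect (arc (transpose E)) p.1 p.2].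
    by apply/setP=> -[x y]; rewrite !inE connect_transpose.
  exact: connectivity_transpose.
have AA : 2 * #|A| <= #|A :&: transpose A| + #|V| ^ 2.
  have:= cardsUI A (transpose A).
  have: #|A :|: transpose A| <= #|{: V * V}| := max_card _.
  rewrite card_prod AT mulnn; lia.
have sum : #|A :&: transpose A| = \sum_x #|scc x|.
  rewrite -sum1_card (eq_bigl (fun p => p.2 \in scc p.1)) => [|p]; last by rewrite !inE.
  rewrite -(pair_big_dep xpredT (fun x y => y \in scc x) (fun _ _ => 1)) /=.
  by apply: eq_bigr => x _; rewrite sum1_card.
have [x0 _] := card_gt0P V0.
pose x := [arg max_(x > x0) #|scc x|].
exists (scc x); split=> //; apply: leq_trans AA _; rewrite leq_add2r sum.
apply: (@leq_trans (\sum_(y : V) #|scc x|)); last by rewrite sum_nat_const.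
by apply: leq_sum => y _; rewrite /x; case: arg_maxnP => // z _; apply.
Qed.

(** This yields the lower bound on the optimum: an induced subgraph on [W] has at most |W| sources
    and at most |W| sinks. *)
Lemma connectivity_within E (W : {set V}) : acyclic E ->
  exists2 N, feasible E #|W| N & #|W| ^ 2 <= connectivity (E :|: N).
Proof.
move=> acE; have acW : acyclic (E :&: within W) by apply: acyclic_sub acE; apply: subsetIl.
have [N [NW NE cN str]] := strong_augmentation (subsetIr E (within W)) acW.
exists N.
  apply/andP; split.
    apply/subsetP=> p pN; have:= subsetP NE _ pN.
    by rewrite !in_setC in_setI (subsetP NW) ?andbT.
  by apply: leq_trans cN _; rewrite geq_max; apply/andP; split;
    apply/subset_leq_card/subsetP=> x; rewrite inE => /andP[].
rewrite -mulnn -cardsX; apply/subset_leq_card/subsetP=> -[x y].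
rewrite !inE /= => /andP[xW yW]; have:= str x y xW yW.
by apply: sub_connect_arc; apply: setSU; apply: subsetIl.
Qed.

Lemma exists_optimal E B : exists N, optimal E B N.
Proof.
have f0 : feasible E B set0 by rewrite /feasible sub0set cards0.
have [N fN maxN] := @arg_maxnP _ set0 (feasible E B) (fun N => connectivity (E :|: N)) f0.
by exists N.
Qed.

End StronglyConnected.

(** * Kernels by classes of twins *)

Section Twins.

Variables (n : nat) (E : {set 'I_n * 'I_n}).
Implicit Types (u v x y : 'I_n) (K X : {set 'I_n}) (N CH : {set 'I_n * 'I_n}).

Definition snk : {set 'I_n} := sinks E setT.

Lemma snkP x : reflect (forall y, (x, y) \notin E) (x \in snk).
Proof. by apply: (iffP (sinksP _ _ _)) => [[]|]. Qed.

Definition twins u v :=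
  [&& u \in snk, v \in snk & [forall l, ((l, u) \in E) == ((l, v) \in E)]].

Lemma twinsP u v : reflect
  [/\ u \in snk, v \in snk & forall l, ((l, u) \in E) = ((l, v) \in E)] (twins u v).
Proof.
apply: (iffP and3P) => -[us vs uv]; split=> //; first by move=> l; apply/eqP/(forallP uv).
by apply/forallP=> l; apply/eqP.
Qed.

Lemma twins_sym u v : twins u v -> twins v u.
Proof. by case/twinsP=> us vs uv; apply/twinsP; split. Qed.

Lemma twins_trans v u w : twins u v -> twins v w -> twins u w.
Proof.
case/twinsP=> us vs uv /twinsP[_ ws vw]; apply/twinsP; split=> // l.
by rewrite uv vw.
Qed.

Lemma twins_refl v : v \in snk -> twins v v.
Proof. by move=> vs; apply/twinsP. Qed.

Definition swap_twins u v N := [set (tperm u v p.1, tperm u v p.2) | p in N].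

Lemma tperm_pair_inj u v : injective (fun p : 'I_n * 'I_n => (tperm u v p.1, tperm u v p.2)).
Proof. by move=> [x y] [x' y'] /= [/perm_inj-> /perm_inj->]. Qed.

Lemma mem_swap_twins u v N x y :
  ((x, y) \in swap_twins u v N) = ((tperm u v x, tperm u v y) \in N).
Proof.
rewrite -{1}[x](tpermK u v) -{1}[y](tpermK u v).
exact: (mem_imset N (tperm u v x, tperm u v y) (@tperm_pair_inj u v)).
Qed.

(** The transposition is an automorphism of the graph: no arc leaves [u] or [v], and the arcs that
    enter them have the same tails. *)
Lemma swap_twinsE u v : twins u v -> swap_twins u v E = E.
Proof.
case/twinsP=> /snkP us /snkP vs uv; apply/setP=> -[x y]; rewrite mem_swap_twins.
have -> : (tperm u v x, tperm u v y) \in E = ((x, tperm u v y) \in E).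
  by case: tpermP => [->|->|//]; rewrite (negbTE (us _)) (negbTE (vs _)).
by case: tpermP => [->|->|//]; rewrite uv.
Qed.

Lemma swap_twinsU u v N N' :
  swap_twins u v (N :|: N') = swap_twins u v N :|: swap_twins u v N'.
Proof. exact: imsetU. Qed.

Lemma swap_twinsK u v : involutive (swap_twins u v).
Proof. by move=> N; apply/setP=> -[x y]; rewrite !mem_swap_twins !tpermK. Qed.

Lemma connect_swap_twins u v N x y :
  connect (arc (swap_twins u v N)) (tperm u v x) (tperm u v y) = connect (arc N) x y.
Proof.
have dir M a b : connect (arc M) a b ->
    connect (arc (swap_twins u v M)) (tperm u v a) (tperm u v b).
  case/connectP=> p pp ->; elim: p a pp => //= c p IHp a /andP[ac pp].
  apply: connect_trans (IHp _ pp); apply: connect1.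
  by rewrite /arc mem_swap_twins !tpermK.
by apply/idP/idP=> [/dir|]; [rewrite swap_twinsK !tpermK | apply: dir].
Qed.

Lemma connectivity_swap_twins u v N : connectivity (swap_twins u v N) = connectivity N.
Proof.
rewrite /connectivity -(card_imset _ (@tperm_pair_inj u v)); apply: eq_card => -[x y].
rewrite -[imset _ _]/(swap_twins u v _) mem_swap_twins !inE /=.
exact: connect_swap_twins.
Qed.

Lemma feasible_swap_twins u v B N : twins u v ->
  feasible E B N -> feasible E B (swap_twins u v N).
Proof.
move=> uv /andP[NE cN]; apply/andP; split.
  apply/subsetP=> -[x y]; rewrite mem_swap_twins => /(subsetP NE).
  by rewrite !inE -mem_swap_twins swap_twinsE.
by rewrite card_imset //; exact: tperm_pair_inj.
Qed.

Definition kept_twins K v := [set u in K | twins u v].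

(* The removed vertices of a class of twins are chained behind [r], the last kept
   vertex of the class, and [last r] is the end of that chain. *)
Definition removed_via h K CH (last : 'I_n -> 'I_n) v r :=
  [/\ r \in kept_twins K v, h <= #|kept_twins K v|,
      {in kept_twins K v, forall u, u <= r},
      connect (arc CH) r v & connect (arc CH) v (last r)].

(** [kernel_card] bounds the cost of the chains by one arc per removed vertex. [kernel_tail] and
    [kernel_lastK] ensure that a lift avoids [E]: its arcs start at sinks, or are unmoved new
    arcs. *)
Record kernel h K CH (last : 'I_n -> 'I_n) : Prop := Kernel {
  kernel_removed : forall v, v \notin K -> exists r, removed_via h K CH last v r;
  kernel_last : {in K, forall a, connect (arc CH) a (last a)};
  kernel_lastK : {in K, forall a, last a = a \/ last a \notin K};
  kernel_card : #|CH| + #|K| <= n;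
  kernel_tail : forall x y, (x, y) \in CH -> x \in snk;
  kernel_class : forall v, #|kept_twins K v| <= h
}.

Definition lift CH (last : 'I_n -> 'I_n) N := CH :|: [set (last p.1, p.2) | p in N].

Hypothesis acE : acyclic E.
Variables (h B : nat) (K : {set 'I_n}) (CH : {set 'I_n * 'I_n}) (last : 'I_n -> 'I_n).
Hypothesis ker : kernel h K CH last.

Lemma removed_snk v : v \notin K -> v \in snk.
Proof. by case/(kernel_removed ker)=> r [rv _ _ _ _]; move: rv; rewrite inE => /and4P[]. Qed.

Lemma removed_unique v v' r r' : removed_via h K CH last v r ->
  removed_via h K CH last v' r' -> twins v v' -> r = r'.
Proof.
move=> [rv _ rmax _ _] [rv' _ rmax' _ _] vv'; apply/val_inj/eqP; rewrite eqn_leq.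
move: rv rv'; rewrite !inE => /andP[rK rv] /andP[rK' rv'].
rewrite rmax' ?inE ?rK ?(twins_trans rv vv') //=.
by rewrite rmax // inE rK' (twins_trans rv' (twins_sym vv')).
Qed.

(** A boolean substitute for the proposition [removed_via], so that [anchored] can be a finite
    set. *)
Definition representative r := [exists v, [&& v \notin K, r \in kept_twins K v &
  [forall u in kept_twins K v, u <= r]]].

Definition anchored : {set 'I_n} := [set x | (x \notin K) || representative x].

Lemma removed_anchored v r : v \notin K -> removed_via h K CH last v r -> r \in anchored.
Proof.
move=> vK [rv _ rmax _ _]; rewrite inE; apply/orP; right.
by apply/existsP; exists v; rewrite vK rv; apply/forall_inP.
Qed.

(* Swapping twins moves the removed vertices and their representatives into
   the large component. *)
Lemma anchor_component m N X : m < h -> feasible E B N -> component (E :|: N) X ->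
  #|~: X| <= m ->
  exists N' X', [/\ feasible E B N', component (E :|: N') X', #|~: X'| <= m,
    anchored \subset X' & connectivity (E :|: N') = connectivity (E :|: N)].
Proof.
move=> mh; have [d] := ubnP #|~: X :&: anchored|; elim: d N X => // d IHd N X led fN cX cardX.
have [sX|] := boolP (anchored \subset X); first by exists N, X.
case/subsetPn=> y yP yX.
(* [y] is either removed itself or the representative of a class with a removed member; both cases
   are treated through such a member [v]. *)
have [v [r [vK vr yv yr]]] : exists v r,
    [/\ v \notin K, removed_via h K CH last v r, twins y v & y \in K -> y = r].
  move: yP; rewrite inE => /orP[yK|/existsP[v /and3P[vK yv /forall_inP ymax]]].
    have [r yr] := kernel_removed ker yK.
    by exists y, r; split; rewrite ?twins_refl ?removed_snk // (negbTE yK).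
  have [r vr] := kernel_removed ker vK; exists v, r; split=> //.
    by move: yv; rewrite inE => /andP[].
  move=> _; apply/val_inj/eqP; rewrite eqn_leq.
  by have [rv _ rmax _ _] := vr; rewrite rmax //= ymax.
(* The class keeps at least h > m vertices. If all of them but [r] were outside [X], they would
   form, together with [y], at least h vertices outside [X]; [y] is not counted twice, being removed
   or equal to [r]. *)
have [z /setDP[zQ zn] zX] : exists2 z, z \in kept_twins K v :\ r & z \in X.
  apply/exists_inP; apply: contraTT mh => /exists_inPn nz; rewrite -leqNgt.
  have [rv hv _ _ _] := vr; apply: leq_trans hv _; rewrite (cardsD1 r) rv add1n.
  apply: leq_trans cardX; apply: leq_ltn_trans (_ : #|~: X :\ y| < _).
    apply/subset_leq_card/subsetP=> z zQ; rewrite in_setD1 in_setC nz // andbT.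
    apply: contraTneq zQ => ->; rewrite !inE; apply/and3P=> -[yr' yK _].
    by rewrite (yr yK) eqxx in yr'.
  by rewrite [X in _ < X](cardsD1 y) in_setC yX.
have {zn} zr : z != r by move: zn; rewrite in_set1.
have [zK zv] : z \in K /\ twins z v by apply/andP; move: zQ; rewrite inE.
(* A class has only one representative, so [z] may leave [X] in exchange for [y], and fewer anchored
   vertices remain outside. *)
have zP : z \notin anchored.
  rewrite inE zK /=; apply/existsP=> -[v' /and3P[vK' zv' /forall_inP zmax]].
  have [r' vr'] := kernel_removed ker vK'.
  have tv : twins v v'.
    by move: zv'; rewrite inE => /andP[_]; apply: twins_trans; apply: twins_sym.
  case/eqP: zr; rewrite (removed_unique vr vr' tv); apply/val_inj/eqP.
  by rewrite eqn_leq; have [rv' _ rmax' _ _] := vr'; rewrite rmax' //= zmax.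
have yz : twins y z := twins_trans yv (twins_sym zv).
pose X' := [set x | tperm y z x \in X].
have EN : E :|: swap_twins y z N = swap_twins y z (E :|: N).
  by rewrite swap_twinsU swap_twinsE.
have yz' : y != z by apply: contraNneq yX => ->.
have XX : ~: X' = z |: (~: X :\ y).
  apply/setP=> x; rewrite !inE; case: tpermP => [->|->|].
  - by rewrite zX eqxx (negbTE yz').
  - by rewrite yX eqxx.
  - by move=> /eqP-> /eqP/negbTE->.
have [||||N' [X'' [? ? ? ? conn]]] := IHd (swap_twins y z N) X'.
- apply: leq_trans (_ : #|~: X :&: anchored| <= d); last by [].
  apply/proper_card/properP; split.
    apply/subsetP=> x; rewrite XX !inE => /andP[/orP[/eqP->|/andP[_ ->]] //].
    by move: zP; rewrite inE => /negbTE->.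
  exists y; first by rewrite inE in_setC yX.
  by rewrite inE XX !inE eqxx (negbTE yz').
- exact: feasible_swap_twins.
- move=> u w; rewrite !inE => uX; rewrite EN (cX _ _ uX).
  by rewrite -!(connect_swap_twins y z (E :|: N)) !tpermK.
- rewrite XX cardsU1 !inE zX andbF /= add1n; apply: leq_trans cardX.
  by rewrite [X in _ <= X](cardsD1 y) in_setC yX.
by exists N', X''; split=> //; rewrite conn EN connectivity_swap_twins.
Qed.

(** The new set is [N1], which makes the kept part [W] of [X] strongly connected, together with
    [N2], the arcs of [N] not inside [X] after contraction of [X] to one vertex [x0]. The hypothesis
    on m + #|~: snk| serves the count of sources, that on m + 1 provides two vertices in [W]. *)
Lemma lift_rewire N X v0 m : feasible E B N -> component (E :|: N) X ->
  anchored \subset X -> #|~: X| <= m -> v0 \notin K ->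
  m + #|~: snk| < h -> m + 1 < h ->
  exists N', [/\ N' \subset within K, feasible E B (lift CH last N')
    & forall x y, connect (arc (E :|: N)) x y ->
        connect (arc (E :|: lift CH last N')) x y].
Proof.
move=> /andP[NE cN] cX sX cardX v0K mc m1.
have RX : ~: K \subset X.
  by apply: subset_trans sX; apply/subsetP=> v; rewrite !inE => ->.
have KX x : x \notin X -> x \in K.
  by apply: contraNT => xK; apply: (subsetP RX); rewrite inE.
have repX v r : v \notin K -> removed_via h K CH last v r -> r \in X :&: K.
  move=> vK vr; rewrite inE (subsetP sX) ?(removed_anchored vK vr) //=.
  by have [+ _ _ _ _] := vr; rewrite inE => /andP[].
have twinsX v : v \notin K -> h <= m + #|kept_twins K v :&: X|.
  move=> vK; have [r [_ hv _ _ _]] := kernel_removed ker vK.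
  apply: leq_trans hv _; rewrite -(cardsID X (kept_twins K v)) addnC leq_add2r.
  apply: leq_trans cardX; apply/subset_leq_card/subsetP=> x.
  by rewrite !inE => /andP[->].
pose W := X :&: K; pose EW := E :&: within W.
have acW : acyclic EW by apply: acyclic_sub acE; apply: subsetIl.
have [N1 [N1W N1E cN1 str]] := strong_augmentation (subsetIr E (within W)) acW.
(* The class of [v0] has at least h - m > 1 kept vertices in [X]. A second vertex of [W] is what
   later forces an arc out of a representative. *)
have W2 : 1 < #|W|.
  apply: (@leq_trans #|kept_twins K v0 :&: X|); first by have:= twinsX _ v0K; lia.
  by apply/subset_leq_card/subsetP=> x; rewrite !inE => /andP[/andP[-> _] ->].
have X2 : 1 < #|X| by apply: leq_trans W2 _; apply/subset_leq_card/subsetIl.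
have outW v w : v \notin K -> (w, v) \in E -> w \in X ->
    exists2 r, r \in W & (w, r) \in E.
  move=> vK wv wX; have [r vr] := kernel_removed ker vK.
  exists r; first exact: repX vr.
  by have [+ _ _ _ _] := vr; rewrite inE => /andP[_ /twinsP[_ _ ->]].
have tailK v w : (w, v) \in E -> w \in K.
  by apply: contraTT => /removed_snk/snkP.
(* An arc to a removed vertex is accompanied by one to its representative, so restricting to kept
   vertices creates no new sinks. *)
have sinksX : #|sinks EW W| + #|~: K| <= #|sinks (E :&: within X) X|.
  rewrite -(cardsID K (sinks (E :&: within X) X)) leq_add //; apply/subset_leq_card/subsetP=> x.
    case/sinksP; rewrite inE => /andP[xX xK] nx; rewrite inE xK andbT.
    apply/sinksP; split=> // y; apply/negP; rewrite !inE => /and3P[xy _ /= yX].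
    have [yK|yK] := boolP (y \in K).
      by have:= nx y; rewrite !inE /= xy xX xK yX yK.
    have [r rW xr] := outW _ _ yK xy xX; move: rW; rewrite inE => /andP[rX rK].
    by have:= nx r; rewrite !inE /= xr xX xK rX rK.
  rewrite !inE => xK; rewrite xK /= (subsetP RX) ?inE //=.
  by apply/forallP=> y; rewrite !inE negb_and (snkP _ (removed_snk xK)).
have cardN : maxn #|sources EW W| #|sinks EW W| + #|~: K| <= #|N :&: within X|.
  have tX := component_sinks cX X2; have sX' := component_sources cX X2.
  rewrite addn_maxl geq_max; apply/andP; split; last exact: leq_trans sinksX tX.
  (* If a removed vertex has an in-neighbour in [X], its kept twins in [X] are sinks but not sources
     of G[W]. They are more numerous than the non-sinks, so there are at most as many sources as
     sinks. Otherwise every removed vertex is a source of G[X], and sources are counted as sinks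
     were. *)
  have [/existsP[v /andP[vK /existsP[w /andP[wv wX]]]]|nex] :=
      boolP [exists v, (v \notin K) && [exists w, ((w, v) \in E) && (w \in X)]].
    apply: leq_trans (leq_trans sinksX tX); rewrite leq_add2r.
    have Zs : kept_twins K v :&: X \subset sinks EW W.
      apply/subsetP=> x; rewrite !inE => /andP[/andP[-> /twinsP[xs _ _]] ->] /=.
      by apply/forallP=> y; rewrite !inE negb_and (snkP _ xs).
    have Zn x : x \in kept_twins K v :&: X -> x \notin sources EW W.
      rewrite inE => /andP[]; rewrite inE => /andP[xK /twinsP[_ _ xv]] xX.
      apply/negP=> /sourcesP[_ /(_ w)].
      by rewrite !inE /= xv wv wX xX xK (tailK _ _ wv).
    have sub : sources EW W \subset
        ~: snk :|: (sinks EW W :\: (kept_twins K v :&: X)).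
      apply/subsetP=> x xs; have [xsk|xsk] := boolP (x \in snk); last by rewrite inE in_setC xsk.
      apply/setUP; right; rewrite in_setD; apply/andP; split.
        by apply: contraTN xs; apply: Zn.
      have [xW _] := sourcesP _ _ _ xs; apply/sinksP; split=> // y.
      by rewrite !inE negb_and (snkP _ xsk).
    apply: leq_trans (subset_leq_card sub) _; apply: leq_trans (leq_card_setU _ _) _.
    rewrite cardsD (setIidPr Zs) addnBA ?subset_leq_card // leq_subLR leq_add2r.
    by rewrite -(leq_add2l m); apply: leq_trans (twinsX v vK); apply: ltnW.
  apply: leq_trans sX'; rewrite -(cardsID K (sources (E :&: within X) X)).
  rewrite leq_add //; apply/subset_leq_card/subsetP=> x.
    case/sourcesP; rewrite inE => /andP[xX xK] nx; rewrite inE xK andbT.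
    apply/sourcesP; split=> // y; apply/negP; rewrite !inE => /and3P[yx /= yX _].
    by have:= nx y; rewrite !inE /= yx xX xK yX (tailK _ _ yx).
  rewrite !inE => xK; rewrite xK /= (subsetP RX) ?inE //=.
  apply/forallP=> y; rewrite !inE /=; apply: contraNN nex => /and3P[yx yX _].
  by apply/existsP; exists x; rewrite xK; apply/existsP; exists y; rewrite yx.
have [x0 x0W] : exists x0, x0 \in W by apply/card_gt0P; apply: ltnW.
pose hub x := if x \in X then x0 else x.
(* Pairs that contraction turns into arcs of [E] are dropped: they are not allowed as new arcs, and
   are available anyway. *)
pose N2 := [set (hub p.1, hub p.2) | p in N :\: within X] :\: E.
have x0K : x0 \in K by move: x0W; rewrite inE => /andP[].
have x0X : x0 \in X by move: x0W; rewrite inE => /andP[].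
have hubK x : hub x \in K by rewrite /hub; case: ifPn => // /KX.
have N'K : N1 :|: N2 \subset within K.
  rewrite subUset; apply/andP; split.
    by apply/subsetP=> p /(subsetP N1W); rewrite !inE => /andP[/andP[_ ->] /andP[_ ->]].
  by apply/subsetP=> p /setDP[/imsetP[q _ ->] _]; rewrite inE /= !hubK.
have N'E p : p \in N1 :|: N2 -> p \notin E.
  case/setUP=> [pN|/setDP[]//]; have:= subsetP N1E _ pN.
  by rewrite in_setC in_setI (subsetP N1W _ pN) andbT.
exists (N1 :|: N2); split=> //.
  apply/andP; split.
    apply/subsetP=> -[x y] /setUP[/(kernel_tail ker)/snkP xs|]; first by rewrite inE.
    case/imsetP=> -[a b] abN [-> ->]; rewrite inE /=.
    have aK : a \in K by have:= subsetP N'K _ abN; rewrite inE => /andP[].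
    have [->|/removed_snk/snkP//] := kernel_lastK ker aK; exact: N'E.
  (* The chains and [N1] are charged to the arcs of [N] inside [X], [N2] to the remaining ones. *)
  apply: leq_trans cN; rewrite -(cardsID (within X) N).
  apply: leq_trans (leq_card_setU _ _) _.
  have c1 := leq_imset_card (fun p => (last p.1, p.2)) (N1 :|: N2).
  have c2 := leq_card_setU N1 N2.
  have c3 : #|N2| <= #|N :\: within X|.
    apply: leq_trans (subset_leq_card (subsetDl _ _)) (leq_imset_card _ _).
  apply: leq_trans (leq_add (leqnn _) (leq_trans c1 (leq_trans c2 (leq_add cN1 c3)))) _.
  rewrite addnA leq_add2r; apply: leq_trans cardN; rewrite addnC leq_add2l.
  by rewrite -(leq_add2r #|K|) [leqRHS]addnC cardsC card_ord (kernel_card ker).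
set L := E :|: lift CH last (N1 :|: N2).
have CHL : subrel (connect (arc CH)) (connect (arc L)).
  by apply: sub_connect_arc; rewrite /L /lift setUCA subsetUl.
have EL x y : (x, y) \in E -> connect (arc L) x y.
  by move=> xy; apply: connect1; rewrite /arc !inE xy.
have lastL a b : (a, b) \in N1 :|: N2 -> connect (arc L) (last a) b.
  move=> abN; apply: connect1; rewrite /arc /L !inE; apply/orP; right; apply/orP; right.
  by apply/imsetP; exists (a, b).
have NL a b : (a, b) \in N1 :|: N2 -> connect (arc L) a b.
  move=> abN; apply: connect_trans (lastL _ _ abN); apply: CHL; apply: (kernel_last ker).
  by have:= subsetP N'K _ abN; rewrite inE => /andP[].
have WL : {in W &, forall x y, connect (arc L) x y}.
  move=> x y xW yW; apply: sub_connect_arcs (str x y xW yW) => a b.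
  by rewrite inE => /orP[|abN]; [rewrite inE => /andP[/EL] | apply: NL; rewrite inE abN].
have hubL x : x \in X -> connect (arc L) x x0 && connect (arc L) x0 x.
  move=> xX; have [xK|xK] := boolP (x \in K).
    by have xW : x \in W; rewrite ?WL // inE xX xK.
  (* A removed [x] is reached through its representative [r]. For the way back, [r] is a sink of
     [E], so a walk from [r] to another vertex of [W] starts with an arc of [N1]; the lift attaches
     this arc to the end of the chain, which [x] reaches. *)
  have [r xr] := kernel_removed ker xK; have rW := repX _ _ xK xr.
  have [rx _ _ chr chx] := xr; have [r' r'W r'r] : exists2 r', r' \in W & r' != r.
    move: W2; rewrite (cardsD1 r) rW => W2.
    by have /card_gt0P[w] : 0 < #|W :\ r| by []; rewrite !inE => /andP[]; exists w => //;
      rewrite inE.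
  have [|z rz zr'] := connect_first (str _ _ rW r'W); first by rewrite eq_sym.
  move: rx; rewrite inE => /andP[_ /twinsP[/snkP rs _ _]].
  have rzN : (r, z) \in N1 by move: rz; rewrite !inE (negbTE (rs z)).
  have zW : z \in W by have:= subsetP N1W _ rzN; rewrite inE => /andP[].
  apply/andP; split; last by apply: connect_trans (WL _ _ x0W rW) (CHL _ _ chr).
  apply: connect_trans (CHL _ _ chx) _; apply: connect_trans (WL _ _ zW x0W).
  by apply: lastL; rewrite inE rzN.
apply: sub_connect_arcs => x y; rewrite inE => /orP[/EL//|xyN].
have hubx z : connect (arc L) z (hub z) && connect (arc L) (hub z) z.
  by rewrite /hub; case: ifP => [/hubL//|_]; rewrite connect0.
have [/andP[xX yX]|nX] := boolP ((x \in X) && (y \in X)).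
  have [/andP[xx _] /andP[_ yy]] := (hubL x xX, hubL y yX).
  exact: connect_trans xx yy.
have [/andP[xx _] /andP[_ yy]] := (hubx x, hubx y).
apply: connect_trans xx _; apply: connect_trans yy.
have [|nE] := boolP ((hub x, hub y) \in E); first exact: EL.
apply: NL; rewrite in_setU; apply/orP; right; rewrite in_setD nE.
by apply/imsetP; exists (x, y); rewrite // in_setD xyN andbT inE.
Qed.

End Twins.

(** All non-sinks are kept. A class of twins is determined by its in-neighbourhood, which is a set
    of non-sinks. *)
Lemma kernel_size n (E : {set 'I_n * 'I_n}) h K CH last :
  kernel E h K CH last -> #|K| <= #|~: snk E| + 2 ^ #|~: snk E| * h.
Proof.
move=> ker; rewrite -(cardsID (snk E) K) addnC leq_add //.
  by apply/subset_leq_card/subsetP=> x; rewrite !inE => /andP[].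
pose inn v := [set l | (l, v) \in E].
rewrite -card_powerset -sum1_card.
rewrite (partition_big inn (mem (powerset (~: snk E)))) /=; last first.
  move=> v _; rewrite powersetE; apply/subsetP=> l; rewrite inE => lv.
  by rewrite inE; apply: contraL lv => /snkP.
rewrite -sum_nat_const; apply: leq_sum => T _; rewrite sum1_card.
rewrite -[X in X <= _]cardsE.
have [->|[v]] := set_0Vmem [set v | (v \in K :&: snk E) && (inn v == T)].
  by rewrite cards0.
rewrite inE => /andP[/setIP[vK vs] /eqP vT]; apply: leq_trans (kernel_class ker v).
apply/subset_leq_card/subsetP=> u; rewrite inE => /andP[/setIP[uK us] /eqP uT].
rewrite inE uK; apply/twinsP; split=> // l.
have /setP/(_ l) : inn u = inn v by rewrite uT vT.
by rewrite !inE.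
Qed.

Theorem kernel_optimal n (E : {set 'I_n * 'I_n}) B k K CH last :
  acyclic E -> k = n - B -> #|~: snk E| < k -> kernel E (6 * k) K CH last ->
  exists N' : {set 'I_n * 'I_n}, [/\ N' \subset within K, feasible E B (lift CH last N')
    & forall N, feasible E B N ->
        connectivity (E :|: N) <= connectivity (E :|: lift CH last N')].
Proof.
move=> acE kE ck ker; have [N [fN Nmax]] := exists_optimal E B.
(* If nothing is removed, [kernel_card] leaves no room for chain arcs and [last] is the identity on
   vertices, so lifting changes nothing. *)
have [KT|/subsetPn[v0 _ v0K]] := boolP (setT \subset K).
  have {}KT : K = setT by apply/eqP; rewrite -subTset.
  have c0 := kernel_card ker; rewrite KT cardsT card_ord in c0.
  have CH0 : CH = set0 by apply/eqP; rewrite -cards_eq0; lia.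
  exists N; have -> : lift CH last N = N.
    rewrite /lift CH0 set0U -[RHS]imset_id; apply: eq_imset => -[x y] /=.
    have xK : x \in K by rewrite KT inE.
    by have [->|] := kernel_lastK ker xK; last by rewrite KT inE.
  by split=> //; apply/subsetP=> p; rewrite KT !inE.
have [r [_ h6 _ _ _]] := kernel_removed ker v0K.
have n6 : 6 * k <= n.
  by apply: leq_trans h6 _; rewrite -[leqRHS]card_ord; apply: max_card.
(* Any [B] vertices would do: connecting them strongly costs at most [B] arcs and gives B^2
   pairs. *)
pose W := [set i : 'I_n | i < B].
have cW : #|W| = B.
  rewrite cardsE -sum1_card -(big_ord_widen _ (fun=> 1)) ?sum1_card ?card_ord //; lia.
have [N0 fN0 cN0] := connectivity_within W acE; rewrite cW in fN0 cN0.
have [|X [cX large]] := @large_component _ (E :|: N); first by rewrite card_ord; lia.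
(* From 2B^2 <= n|X| + n^2 and n = B + k follows n(n - |X|) <= 2(n^2 - B^2) = 2k(n + B) <= 4kn. *)
have cardX : #|~: X| <= 4 * k.
  have n0 : 0 < n by lia.
  have Bk : n = B + k by lia.
  have XC : n = #|X| + #|~: X| by rewrite cardsC card_ord.
  have conn0 := leq_trans cN0 (Nmax _ fN0); rewrite card_ord in large.
  rewrite -(leq_pmul2l n0); have {}large : 2 * B ^ 2 <= n * #|X| + n ^ 2.
    by apply: leq_trans large; rewrite leq_mul2l.
  move: large XC; rewrite -!mulnn; move: #|X| #|~: X| => p q large XC.
  clear -large XC Bk; subst n;
    have {XC large} : 2 * (B * B) + (B + k) * q <= 2 * ((B + k) * (B + k)).
    by rewrite {2 3}XC; nia.
  nia.
(* With m = 4k and at most k - 1 non-sinks, the quota 6k exceeds m, m + 1 and m plus the number of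
   non-sinks, as k is positive. *)
have [|N1 [X1 [fN1 cX1 cardX1 anch conn1]]] := anchor_component ker _ fN cX cardX.
  lia.
have [||N' [N'K fN' sub]] := lift_rewire acE ker fN1 cX1 anch cardX1 v0K; try lia.
exists N'; split=> // N2 /Nmax/leq_trans; apply; rewrite -conn1; exact: sub_connectivity.
Qed.

(** * Loop programs *)

(* [PFor x b p] runs [p] for [x] = 0, 1, ... while [x] is below the bound stored
   in [b]; scalars are kept at index 0 of the array that bears their name. *)
Inductive prog : Type :=
| PSkip
| PWrite (a : nat) (i e : expr)
| PSeq (p q : prog)
| PIf (e : expr) (p q : prog)
| PFor (x b : nat) (p : prog).

Notation var x := (Read x (Const 0)).
Notation "p ;; q" := (PSeq p q) (at level 90, right associativity).

Fixpoint compile (p : prog) : cmd :=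
  match p with
  | PSkip => Skip
  | PWrite a i e => Write a i e
  | PSeq p q => Seq (compile p) (compile q)
  | PIf e p q => If e (compile p) (compile q)
  | PFor x b p => Seq (Write x (Const 0) (Const 0))
      (While (Sub (var b) (var x))
        (Seq (compile p) (Write x (Const 0) (Add (var x) (Const 1)))))
  end.

Definition next x (s : store) : store := update s x 0 (s x 0 + 1).

Fixpoint den (p : prog) (s : store) : store :=
  match p with
  | PSkip => s
  | PWrite a i e => update s a (eval s i) (eval s e)
  | PSeq p q => den q (den p s)
  | PIf e p q => if eval s e != 0 then den p s else den q s
  | PFor x b p => iter (s b 0) (fun s' => next x (den p s')) (update s x 0 0)
  end.

Fixpoint mods (p : prog) : seq nat :=
  match p with
  | PSkip => [::]
  | PWrite a _ _ => [:: a]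
  | PSeq p q => mods p ++ mods q
  | PIf _ p q => mods p ++ mods q
  | PFor x _ p => x :: mods p
  end.

Fixpoint bounds (p : prog) : seq nat :=
  match p with
  | PSkip | PWrite _ _ _ => [::]
  | PSeq p q => bounds p ++ bounds q
  | PIf _ p q => bounds p ++ bounds q
  | PFor _ b p => b :: bounds p
  end.

(** The compiled loop reads its counter and its bound afresh in every round, while [den] reads the
    bound once. The two agree because the body writes neither. *)
Fixpoint wf (p : prog) : bool :=
  match p with
  | PSkip | PWrite _ _ _ => true
  | PSeq p q => wf p && wf q
  | PIf _ p q => wf p && wf q
  | PFor x b p => [&& x != b, x \notin mods p, b \notin mods p & wf p]
  end.

(** In a loop, 9 is the initialization of the counter (3) plus the failing test (6); 12 is the
    successful test (6) plus the increment (6). A conditional is charged for both branches. *)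
Fixpoint cost (bd : nat -> nat) (p : prog) : nat :=
  match p with
  | PSkip => 1
  | PWrite a i e => (eval_time i + eval_time e).+1
  | PSeq p q => cost bd p + cost bd q
  | PIf e p q => (eval_time e + (cost bd p + cost bd q)).+1
  | PFor x b p => 9 + bd b * (cost bd p + 12)
  end.

Lemma den_seq p q s : den (p ;; q) s = den q (den p s). Proof. by []. Qed.
Lemma den_if e p q s : den (PIf e p q) s = if eval s e != 0 then den p s else den q s.
Proof. by []. Qed.
Lemma den_write a i e s : den (PWrite a i e) s = update s a (eval s i) (eval s e).
Proof. by []. Qed.

Lemma update_neq s a i v b j : a != b -> update s a i v b j = s b j.
Proof. by rewrite /update eq_sym => /negbTE->. Qed.

Lemma update_eq s a i v j : update s a i v a j = if j == i then v else s a j.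
Proof. by rewrite /update eqxx. Qed.

Lemma frame p s a i : a \notin mods p -> den p s a i = s a i.
Proof.
elim: p s => [|b j e|p IHp q IHq|e p IHp q IHq|x b p IHp] s //=.
- by rewrite inE eq_sym => /update_neq->.
- by rewrite mem_cat negb_or => /andP[ap aq]; rewrite IHq ?IHp.
- by rewrite mem_cat negb_or => /andP[ap aq]; case: ifP; rewrite (IHp, IHq).
rewrite inE negb_or eq_sym => /andP[xa ap].
have -> : s a i = update s x 0 0 a i by rewrite update_neq.
by elim: (s b 0) (update s x 0 0) => //= m IHm s'; rewrite /next update_neq // IHp.
Qed.

(* Bounds that the program itself writes are excluded: the initial store does not
   determine the cost of their loops. *)
Lemma exec_compile p bd s : wf p -> (forall b, b \in bounds p -> b \notin mods p) ->
  (forall b, b \in bounds p -> s b 0 <= bd b) ->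
  exists2 t, exec (compile p) s t (den p s) & t <= cost bd p.
Proof.
elim: p s => [|a i e|p IHp q IHq|e p IHp q IHq|x b p IHp] s /=.
- by exists 1 => //; apply: exec_skip.
- by eexists; first exact: exec_write.
- move=> /andP[wp wq] fr le.
  have notin b : b \in bounds p \/ b \in bounds q -> (b \notin mods p) && (b \notin mods q).
    by move=> bpq; rewrite -negb_or -mem_cat fr // mem_cat; apply/orP.
  have [||t1 ex1 le1] := IHp s wp.
  + by move=> b bp; have /andP[] := notin b (or_introl bp).
  + by move=> b bp; apply: le; rewrite mem_cat bp.
  have [||t2 ex2 le2] := IHq (den p s) wq.
  + by move=> b bq; have /andP[] := notin b (or_intror bq).
  + move=> b bq; have /andP[bp _] := notin b (or_intror bq).
    by rewrite frame // le // mem_cat bq orbT.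
  by exists (t1 + t2); [apply: exec_seq ex1 ex2 | apply: leq_add].
- move=> /andP[wp wq] fr le.
  have notin b : b \in bounds p \/ b \in bounds q -> (b \notin mods p) && (b \notin mods q).
    by move=> bpq; rewrite -negb_or -mem_cat fr // mem_cat; apply/orP.
  have [||t1 ex1 le1] := IHp s wp.
  + by move=> b bp; have /andP[] := notin b (or_introl bp).
  + by move=> b bp; apply: le; rewrite mem_cat bp.
  have [||t2 ex2 le2] := IHq s wq.
  + by move=> b bq; have /andP[] := notin b (or_intror bq).
  + by move=> b bq; rewrite le // mem_cat bq orbT.
  case: (boolP (eval s e != 0)) => ev.
    exists (eval_time e + t1).+1; first exact: exec_if_true.
    by rewrite ltnS leq_add2l (leq_trans le1) ?leq_addr.
  exists (eval_time e + t2).+1; first by apply: exec_if_false; rewrite ?negbK in ev *.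
  by rewrite ltnS leq_add2l (leq_trans le2) ?leq_addl.
move=> /and4P[xb xp bp wp] fr le.
set loop := While _ _; set step := fun s' => next x (den p s').
(* [m] is the number of rounds still to come, so the induction can start from any intermediate
   store. *)
suff run m s' : s' b 0 = s' x 0 + m -> s' b 0 = s b 0 ->
    (forall b', b' \in bounds p -> s' b' 0 = s b' 0) ->
    exists2 t, exec loop s' t (iter m step s') & t <= 6 + m * (cost bd p + 12).
  have [||| t ex let_] := run (s b 0) (update s x 0 0).
  - by rewrite update_eq eqxx update_neq.
  - by rewrite update_neq.
  - move=> b' b'p; rewrite update_neq //.
    by have:= fr b'; rewrite !inE b'p orbT negb_or eq_sym => /(_ isT)/andP[].
  exists (3 + t); first by apply: exec_seq ex; exact: exec_write.
  have:= le b; rewrite inE eqxx => /(_ isT) sb.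
  rewrite -[9]/(3 + 6) -addnA leq_add2l; apply: leq_trans let_ _.
  by rewrite leq_add2l leq_mul2r sb orbT.
elim: m s' => [|m IHm] s' sb' sb fb.
  by exists 6 => //; apply: exec_while_false; rewrite /= sb' addn0 subnn.
have [||t1 ex1 le1] := IHp s' wp.
- by move=> b' b'p; have:= fr b'; rewrite !inE b'p orbT negb_or => /(_ isT)/andP[].
- by move=> b' b'p; rewrite fb // le // inE b'p orbT.
have [|||t2 ex2 le2] := IHm (step s').
- by rewrite /step /next update_neq // update_eq eqxx !frame // sb' addnS addn1 addSn.
- by rewrite /step /next update_neq // frame.
- move=> b' b'p; have:= fr b'; rewrite !inE b'p orbT negb_or eq_sym => /(_ isT)/andP[b'x b'm].
  by rewrite /step /next update_neq // frame // fb.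
exists (5 + (t1 + 6) + t2).+1.
  rewrite iterSr; apply: exec_while_true ex2; first by rewrite /= sb' addnC addnK.
  by apply: exec_seq ex1 _; exact: exec_write.
rewrite mulSn; lia.
Qed.

(** Each loop raises the degree by one. Sums are bounded by adding degrees, which is crude but
    spares comparing them. *)
Lemma cost_polynomial p : exists C d, forall bd n,
  (forall b, b \in bounds p -> bd b <= n) -> cost bd p <= C * n.+1 ^ d.
Proof.
have comb C d D e n : C * n.+1 ^ d + D * n.+1 ^ e <= (C + D) * n.+1 ^ (d + e).
  by rewrite mulnDl leq_add // leq_mul2l leq_pexp2l ?leq_addr ?leq_addl ?orbT.
elim: p => [|a i e|p [C [d IHp]] q [D [d' IHq]]|e p [C [d IHp]] q [D [d' IHq]]|x b p [C [d IHp]]].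
- by exists 1, 0 => bd n _.
- by exists (eval_time i + eval_time e).+1, 0 => bd n _; rewrite /= muln1.
- exists (C + D), (d + d') => bd n le /=; apply: leq_trans (comb _ _ _ _ _).
  by apply: leq_add; [apply: IHp|apply: IHq] => b bp; apply: le; rewrite mem_cat bp ?orbT.
- exists ((eval_time e).+1 + (C + D)), (0 + (d + d')) => bd n le /=.
  rewrite -addSn; apply: leq_trans (comb _ _ _ _ _); rewrite muln1 leq_add2l.
  apply: leq_trans (comb _ _ _ _ _).
  by apply: leq_add; [apply: IHp|apply: IHq] => b bp; apply: le; rewrite mem_cat bp ?orbT.
exists (9 + (C + 12)), (0 + (d + 0).+1) => bd n le /=.
apply: leq_trans (comb _ _ _ _ _); rewrite muln1 leq_add2l.
rewrite expnS mulnCA leq_mul //.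
  by apply: leqW; apply: le; rewrite inE eqxx.
apply: leq_trans (comb _ _ _ _ _); rewrite muln1 leq_add2r.
by apply: IHp => b' b'p; apply: le; rewrite inE b'p orbT.
Qed.

(** The invariant must survive any write to the counter, since the counter is reset at the start and
    advanced after each run of the body. *)
Lemma for_ind (I : nat -> store -> Prop) x b p s :
  wf (PFor x b p) ->
  (forall i s' v, I i s' -> I i (update s' x 0 v)) ->
  I 0 s ->
  (forall i s', i < s b 0 -> s' x 0 = i ->
     (forall a j, a \notin x :: mods p -> s' a j = s a j) ->
     I i s' -> I i.+1 (den p s')) ->
  I (s b 0) (den (PFor x b p) s).
Proof.
case/and4P=> xb xp bp wp Ix I0 step.
suff: forall m, m <= s b 0 -> let s' := iter m (fun s' => next x (den p s')) (update s x 0 0) in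
    [/\ I m s', s' x 0 = m & forall a j, a \notin x :: mods p -> s' a j = s a j].
  by move=> /(_ _ (leqnn _))[].
elim=> [_|m IHm lem] /=.
  split; [exact: Ix | by rewrite update_eq | move=> a j].
  by rewrite inE negb_or eq_sym => /andP[/update_neq->].
have [Im xm fr] := IHm (ltnW lem); split.
- by apply: Ix; apply: step.
- by rewrite /next update_eq eqxx frame // xm addn1.
move=> a j an; rewrite -fr //; move: an; rewrite inE negb_or eq_sym => /andP[xa ap].
by rewrite /next update_neq // frame.
Qed.

(** * Basic procedures and evaluation of a candidate *)

Arguments den : simpl never.

(** Any nonzero number counts as true, so the operands are first negated into 0 or 1 by truncated
    subtraction. [Add] serves as disjunction. *)
Definition eand e1 e2 := Sub (Const 1) (Add (Sub (Const 1) e1) (Sub (Const 1) e2)).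
Definition enot e := Sub (Const 1) e.
Definition eneq e1 e2 := Add (Sub e1 e2) (Sub e2 e1).

Lemma eval_and s e1 e2 :
  (eval s (eand e1 e2) != 0) = (eval s e1 != 0) && (eval s e2 != 0).
Proof. by rewrite /=; lia. Qed.

Lemma eval_not s e : (eval s (enot e) != 0) = (eval s e == 0).
Proof. by rewrite /=; lia. Qed.

Lemma eval_neq s e1 e2 : (eval s (eneq e1 e2) != 0) = (eval s e1 != eval s e2).
Proof. by rewrite /=; lia. Qed.

Lemma eval_or s e1 e2 : (eval s (Add e1 e2) != 0) = (eval s e1 != 0) || (eval s e2 != 0).
Proof. by rewrite /=; lia. Qed.

(* Names of arrays: [i]ndices of loops, [f]lags and [v]ariables only use entry 0.
   [aRow] tabulates the multiples of the number of vertices, which the machine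
   cannot compute by a multiplication. *)
Notation aAdj := 1.
Notation aBest := 2.
Notation aRow := 3.
Notation aCand := 4.
Notation aReach := 5.
Notation vBest := 6.
Notation iMid := 7.
Notation iFrom := 8.
Notation iTo := 9.
Notation iTail := 10.
Notation iHead := 11.
Notation fClash := 12.
Notation vCard := 13.
Notation vConn := 14.
Notation iScan := 15.
Notation fEntered := 16.
Notation fLeft := 17.
Notation iSink := 18.
Notation iSource := 19.
Notation vSources := 20.
Notation vSinks := 21.
Notation aSources := 22.
Notation aSinks := 23.
Notation iEnd := 24.
Notation vSource := 25.
Notation vSink := 26.
Notation aNonsink := 27.
Notation vNonsinks := 28.
Notation vQuota := 29.
Notation aKept := 30.
Notation aLast := 31.
Notation aChain := 32.
Notation aSubset := 33.
Notation vSubsets := 34.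
Notation vTwins := 35.
Notation vRep := 36.
Notation fDiffer := 37.
Notation iVert := 38.
Notation iTwin := 39.
Notation iNbr := 40.
Notation fCarry := 41.
Notation iSubset := 42.
Notation iKeptTail := 43.
Notation iKeptHead := 44.
Notation aTemp := 45.
Notation vParam := 46.

Definition ecell x y := Add (Read aRow (var x)) (var y).
Notation ent a x y := (Read a (ecell x y)).

Definition PFor2 x y p := PFor x 0 (PFor y 0 p).
Definition PAny f x e :=
  PWrite f (Const 0) (Const 0);; PFor x 0 (PIf e (PWrite f (Const 0) (Const 1)) PSkip).
Definition PCount c x e :=
  PWrite c (Const 0) (Const 0);;
  PFor x 0 (PIf e (PWrite c (Const 0) (Add (var c) (Const 1))) PSkip).
Definition PAny2 f x y e :=
  PWrite f (Const 0) (Const 0);; PFor2 x y (PIf e (PWrite f (Const 0) (Const 1)) PSkip).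
Definition PCount2 c x y e :=
  PWrite c (Const 0) (Const 0);;
  PFor2 x y (PIf e (PWrite c (Const 0) (Add (var c) (Const 1))) PSkip).
Definition PFill a x y e :=
  PFor2 x y (PIf e (PWrite a (ecell x y) (Const 1)) (PWrite a (ecell x y) (Const 0))).

Section Cells.

Variable n : nat.
Implicit Types (s : store) (p c : 'I_n * 'I_n) (P Q : {set 'I_n * 'I_n}).

Lemma cell_inj : injective (@cell n).
Proof.
move=> [i j] [i' j']; rewrite /cell /= => eq.
have n0 : 0 < n by apply: leq_ltn_trans (ltn_ord i).
congr (_, _); apply: val_inj => /=.
  by have := congr1 (divn^~ n) eq; rewrite !divnMDl // !divn_small // !addn0.
by have := congr1 (modn^~ n) eq; rewrite !modnMDl !modn_small.
Qed.

Lemma cell_eq p c : (cell p == cell c) = (p == c).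
Proof. exact: (inj_eq cell_inj). Qed.

Lemma cell_lt p : cell p < n * n.
Proof. by case: p => i j; rewrite /cell /=; have := ltn_ord i; have := ltn_ord j; nia. Qed.

Lemma cell_ltS p c : (cell p < (cell c).+1) = (p == c) || (cell p < cell c).
Proof. by rewrite ltnS leq_eqVlt cell_eq. Qed.

Definition std s := s 0 0 = n /\ forall i : 'I_n, s aRow i = i * n.

Lemma std_eq s s' : (forall j, s' 0 j = s 0 j) -> (forall j, s' aRow j = s aRow j) ->
  std s -> std s'.
Proof. by move=> e0 e3 [n0 row]; split=> [|i]; rewrite (e0, e3). Qed.

Lemma std_frame q s : 0 \notin mods q -> aRow \notin mods q -> std s -> std (den q s).
Proof. by move=> m0 m3; apply: std_eq => j; rewrite frame. Qed.

Definition repr s a P := forall p, s a (cell p) = (p \in P).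

Lemma repr_eq s s' a P : (forall j, s' a j = s a j) -> repr s a P -> repr s' a P.
Proof. by move=> e r p; rewrite e. Qed.

Lemma repr_frame q s a P : a \notin mods q -> repr s a P -> repr (den q s) a P.
Proof. by move=> m; apply: repr_eq => j; rewrite frame. Qed.

Lemma repr_update s a P Q c (b : bool) :
  (forall p, (p \in Q) = if p == c then b else p \in P) ->
  repr s a P -> repr (update s a (cell c) b) a Q.
Proof. by move=> eQ r p; rewrite update_eq cell_eq eQ; case: ifP. Qed.

Lemma repr_neq0 s a P p : repr s a P -> (s a (cell p) != 0) = (p \in P).
Proof. by move=> ->; case: (_ \in _). Qed.

Lemma repr_ext s a P Q : P =i Q -> repr s a P -> repr s a Q.
Proof. by move=> eq r p; rewrite r eq. Qed.

Lemma eval_cell s x y (u v : 'I_n) : std s -> s x 0 = u -> s y 0 = v ->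
  eval s (ecell x y) = cell (u, v).
Proof. by move=> [_ row] xu yv; rewrite /= xu yv row. Qed.

(** Nested loops visit the pairs in the order of their row-major numbers, so a single invariant
    indexed by [cell] covers both loops. *)
Lemma for2_ind (I : nat -> store -> Prop) x y q s :
  wf (PFor2 x y q) -> s 0 0 = n ->
  (forall i s' v, I i s' -> I i (update s' x 0 v)) ->
  (forall i s' v, I i s' -> I i (update s' y 0 v)) ->
  I 0 s ->
  (forall c s', s' x 0 = c.1 -> s' y 0 = c.2 ->
     (forall a j, a \notin [:: x, y & mods q] -> s' a j = s a j) ->
     I (cell c) s' -> I (cell c).+1 (den q s')) ->
  I (n * n) (den (PFor2 x y q) s).
Proof.
move=> wfq n0 Ix Iy I0 step; have /and4P[x0 xq bq wfy] := wfq.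
rewrite -{1}n0; apply: (@for_ind (fun i => I (i * n))) => // [i s' v|i s1 lei xi fr Ii].
  exact: Ix.
have s10 : s1 0 0 = n by rewrite fr // !inE negb_or (eq_sym 0) x0.
rewrite mulSn addnC -{2}s10.
apply: (@for_ind (fun j => I (i * n + j))) => //; first by move=> j s' v; apply: Iy.
  by rewrite addn0.
move=> j s2 ltj yj fr2 Ij; rewrite s10 n0 in ltj lei; rewrite addnS.
apply: (step (Ordinal lei, Ordinal ltj)) => //=.
  rewrite fr2 ?xi //; move: xq; rewrite /= !inE negb_or => /andP[-> ->] //.
move=> a k an; rewrite fr2; last by move: an; rewrite !inE !negb_or => /and3P[_ -> ->].
by rewrite fr //= !inE.
Qed.

Lemma any_spec f x e (P : pred 'I_n) s : wf (PAny f x e) -> s 0 0 = n -> f != 0 -> x != f ->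
  (forall (l : 'I_n) s', s' x 0 = l -> (forall a j, a \notin [:: x; f] -> s' a j = s a j) ->
    (eval s' e != 0) = P l) ->
  den (PAny f x e) s f 0 = [exists l, P l].
Proof.
move=> /andP[_ wfx] n0 f0 xf Pe; rewrite den_seq den_write /=; set s0 := update _ _ _ _.
have s00 : s0 0 0 = n by rewrite /s0 update_neq.
pose I i (s' : store) := s' f 0 = [exists l : 'I_n, (l < i) && P l].
suff : I (s0 0 0) (den (PFor x 0 (PIf e (PWrite f (Const 0) (Const 1)) PSkip)) s0).
  by rewrite /= s00 => ->; congr nat_of_bool; apply: eq_existsb => l; rewrite ltn_ord.
apply: (@for_ind I) => //.
- by move=> i s' v; rewrite /I update_neq.
- by rewrite /I /s0 update_eq; case: existsP => // -[l /andP[]].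
move=> i s' lti xi fr; rewrite s00 in lti; rewrite /I => IH.
have ev : (eval s' e != 0) = P (Ordinal lti).
  apply: Pe => // a j; rewrite !inE negb_or => /andP[ax af].
  by rewrite fr ?inE /= ?negb_or ?ax ?af // /s0 update_neq // eq_sym.
rewrite den_if ev; have [Pl|nPl] := boolP (P (Ordinal lti)).
  rewrite den_write /= update_eq eqxx; case: existsP => // -[].
  by exists (Ordinal lti); rewrite /= leqnn.
rewrite /den /= IH; congr nat_of_bool; apply: eq_existsb => l.
rewrite [in RHS]ltnS [in RHS]leq_eqVlt; case: eqP => [li|//].
have -> : l = Ordinal lti by apply: val_inj.
by rewrite (negbTE nPl) !andbF.
Qed.

Lemma count_spec f x e (P : pred 'I_n) s : wf (PCount f x e) -> s 0 0 = n -> f != 0 -> x != f ->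
  (forall (l : 'I_n) s', s' x 0 = l -> (forall a j, a \notin [:: x; f] -> s' a j = s a j) ->
    (eval s' e != 0) = P l) ->
  den (PCount f x e) s f 0 = #|P|.
Proof.
move=> /andP[_ wfx] n0 f0 xf Pe; rewrite den_seq den_write /=; set s0 := update _ _ _ _.
have s00 : s0 0 0 = n by rewrite /s0 update_neq.
pose I i (s' : store) := s' f 0 = #|[pred l : 'I_n | (l < i) && P l]|.
suff : I (s0 0 0) (den (PFor x 0 (PIf e (PWrite f (Const 0) (Add (var f) (Const 1))) PSkip)) s0).
  by rewrite /= s00 => ->; apply: eq_card => l; rewrite !inE ltn_ord.
apply: (@for_ind I) => //.
- by move=> i s' v; rewrite /I update_neq.
- by rewrite /I /s0 update_eq /= (eq_card0 (A := [pred _ | _])).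
move=> i s' lti xi fr; rewrite s00 in lti; rewrite /I => IH.
have ev : (eval s' e != 0) = P (Ordinal lti).
  apply: Pe => // a j; rewrite !inE negb_or => /andP[ax af].
  by rewrite fr ?inE /= ?negb_or ?ax ?af // /s0 update_neq // eq_sym.
rewrite (cardD1 (Ordinal lti)) inE /= leqnn /= den_if ev.
have -> : #|[predD1 [pred l : 'I_n | (l < i.+1) && P l] & Ordinal lti]|
    = #|[pred l : 'I_n | (l < i) && P l]|.
  by apply: eq_card => l; rewrite !inE ltnS leq_eqVlt -val_eqE /=; case: eqP => [->|//];
    rewrite ltnn.
by case: (P _); rewrite /den /= ?update_eq /= IH ?addn1.
Qed.

Lemma any2_spec f x y e (P : pred ('I_n * 'I_n)) s : wf (PAny2 f x y e) -> s 0 0 = n ->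
  f \notin [:: 0; x; y] ->
  (forall c s', s' x 0 = c.1 -> s' y 0 = c.2 ->
    (forall a j, a \notin [:: x; y; f] -> s' a j = s a j) -> (eval s' e != 0) = P c) ->
  den (PAny2 f x y e) s f 0 = [exists c, P c].
Proof.
move=> /andP[_ wfx] n0; rewrite !inE !negb_or => /and3P[f0 fx fy] Pe.
rewrite den_seq den_write /=; set s0 := update _ _ _ _.
have s00 : s0 0 0 = n by rewrite /s0 update_neq.
pose I i (s' : store) := s' f 0 = [exists c, (cell c < i) && P c].
suff : I (n * n) (den (PFor2 x y (PIf e (PWrite f (Const 0) (Const 1)) PSkip)) s0).
  by move=> /= ->; congr nat_of_bool; apply: eq_existsb => l; rewrite cell_lt.
apply: (@for2_ind I) => //.
- by move=> i s' v; rewrite /I update_neq // eq_sym.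
- by move=> i s' v; rewrite /I update_neq // eq_sym.
- by rewrite /I /s0 update_eq; case: existsP => // -[l /andP[]].
move=> c s' xi yi fr; rewrite /I => IH.
have ev : (eval s' e != 0) = P c.
  apply: Pe => // a j; rewrite !inE !negb_or => /and3P[ax ay af].
  by rewrite fr ?inE /= ?negb_or ?ax ?ay ?af // /s0 update_neq // eq_sym.
rewrite den_if ev; have [Pl|nPl] := boolP (P c).
  rewrite den_write /= update_eq eqxx; case: existsP => // -[].
  by exists c; rewrite leqnn.
rewrite /den /= IH; congr nat_of_bool; apply: eq_existsb => l.
by rewrite cell_ltS; case: eqP => [->|//]; rewrite (negbTE nPl) !andbF.
Qed.

Lemma count2_spec f x y e (P : pred ('I_n * 'I_n)) s : wf (PCount2 f x y e) -> s 0 0 = n ->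
  f \notin [:: 0; x; y] ->
  (forall c s', s' x 0 = c.1 -> s' y 0 = c.2 ->
    (forall a j, a \notin [:: x; y; f] -> s' a j = s a j) -> (eval s' e != 0) = P c) ->
  den (PCount2 f x y e) s f 0 = #|P|.
Proof.
move=> /andP[_ wfx] n0; rewrite !inE !negb_or => /and3P[f0 fx fy] Pe.
rewrite den_seq den_write /=; set s0 := update _ _ _ _.
have s00 : s0 0 0 = n by rewrite /s0 update_neq.
pose I i (s' : store) := s' f 0 = #|[pred c | (cell c < i) && P c]|.
suff : I (n * n) (den (PFor2 x y (PIf e (PWrite f (Const 0) (Add (var f) (Const 1))) PSkip)) s0).
  by move=> /= ->; apply: eq_card => l; rewrite !inE cell_lt.
apply: (@for2_ind I) => //.
- by move=> i s' v; rewrite /I update_neq // eq_sym.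
- by move=> i s' v; rewrite /I update_neq // eq_sym.
- by rewrite /I /s0 update_eq /= (eq_card0 (A := [pred _ | _])).
move=> c s' xi yi fr; rewrite /I => IH.
have ev : (eval s' e != 0) = P c.
  apply: Pe => // a j; rewrite !inE !negb_or => /and3P[ax ay af].
  by rewrite fr ?inE /= ?negb_or ?ax ?ay ?af // /s0 update_neq // eq_sym.
rewrite (cardD1 c) inE leqnn /= den_if ev.
have -> : #|[predD1 [pred c' | (cell c' < (cell c).+1) && P c'] & c]|
    = #|[pred c' | (cell c' < cell c) && P c']|.
  apply: eq_card => l; rewrite !inE cell_ltS; case: eqP => [->|//] /=.
  by rewrite ltnn.
by case: (P _); rewrite /den /= ?update_eq /= IH ?addn1.
Qed.

Lemma fill_spec f x y e (P : pred ('I_n * 'I_n)) s : wf (PFill f x y e) -> std s ->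
  f \notin [:: 0; aRow; x; y] -> aRow \notin [:: x; y] ->
  (forall c s', s' x 0 = c.1 -> s' y 0 = c.2 ->
    (forall a j, a \notin [:: x; y; f] -> s' a j = s a j) -> (eval s' e != 0) = P c) ->
  repr (den (PFill f x y e) s) f [set c | P c].
Proof.
move=> wfx st; have [n0 _] := st.
rewrite !inE !negb_or => /and4P[f0 f3 fx fy] /andP[rx ry] Pe.
pose I i (s' : store) := forall p, cell p < i -> s' f (cell p) = P p.
suff Q : I (n * n) (den (PFill f x y e) s).
  by move=> p; rewrite inE; apply: Q; apply: cell_lt.
apply: (@for2_ind I) => //.
- by move=> i s' v Q p; rewrite update_neq 1?eq_sym //; apply: Q.
- by move=> i s' v Q p; rewrite update_neq 1?eq_sym //; apply: Q.
move=> c s' xi yi fr; rewrite /I => IH p.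
have st' : std s'.
  have /and4P[/= x0 _ _ /and4P[y0 _ _ _]] := wfx.
  by apply: std_eq st => j; rewrite fr //= !inE !negb_or
    ?(eq_sym 0) ?(x0, y0, f0, rx, ry) //= (eq_sym aRow) f3.
have ec : eval s' (ecell x y) = cell c by rewrite (eval_cell st' xi yi); case: (c).
have ev : (eval s' e != 0) = P c.
  apply: Pe => // a j; rewrite !inE !negb_or => /and3P[ax ay af].
  by rewrite fr //= !inE !negb_or ax ay af.
rewrite cell_ltS den_if ev !den_write ec.
rewrite -cell_eq; case: eqP => [/cell_inj->|/eqP/negbTE cp] /=.
  by case: ifP => _; rewrite update_eq eqxx.
by case: ifP => Pc; rewrite update_eq cp; apply: IH.
Qed.

End Cells.

(** * Reachability by Warshall's algorithm *)

Definition closure :=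
  PFill aReach iFrom iTo (Add (enot (eneq (var iFrom) (var iTo))) (Add (ent aAdj iFrom iTo)
    (ent aCand iFrom iTo)));;
  PFor iMid 0 (PFor2 iFrom iTo (PIf (eand (ent aReach iFrom iMid) (ent aReach iMid iTo))
    (PWrite aReach (ecell iFrom iTo) (Const 1)) PSkip)).

Lemma closure_spec n s (E M : {set 'I_n * 'I_n}) : std n s ->
  repr s aAdj E -> repr s aCand M ->
  repr (den closure s) aReach [set p | connect (arc (E :|: M)) p.1 p.2].
Proof.
move=> st rE rM; rewrite den_seq.
set e := Add _ (Add _ _).
move: (den (PFill aReach iFrom iTo e) s)
  (@std_frame n (PFill aReach iFrom iTo e) s isT isT st)
  (@fill_spec n aReach iFrom iTo e
     (fun c => (c.1 == c.2) || ((c \in E) || (c \in M))) s isT st isT isT) => s1 st1 r1.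
pose G := E :|: M; pose T0 := [set c : 'I_n * 'I_n | (c.1 == c.2) || ((c \in E) || (c \in M))].
have {}r1 : repr s1 aReach T0.
  apply: r1 => c s' xc yc fr.
  have st' : std n s' by apply: std_eq st => j; rewrite fr.
  rewrite /e !eval_or eval_not -[eval _ _ == 0]negbK eval_neq negbK /= xc yc.
  by have [_ ->] := st'; rewrite !fr // -/(cell c) rE rM; case: (_ \in E); case: (_ \in M).
(* Closure under composition through the vertices below [k] takes the place of the usual statement
   about walks; after the last round it is transitivity. *)
pose warshall k (T : {set 'I_n * 'I_n}) := [/\ T0 \subset T,
  forall p, p \in T -> connect (arc G) p.1 p.2
  & forall m : 'I_n, m < k -> forall i j, (i, m) \in T -> (m, j) \in T -> (i, j) \in T].
pose I k s' := exists2 T, repr s' aReach T & warshall k T.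
have {e} loop : I (s1 0 0) (den (PFor iMid 0 (PFor2 iFrom iTo (PIf (eand (ent aReach iFrom iMid)
  (ent aReach iMid iTo))
    (PWrite aReach (ecell iFrom iTo) (Const 1)) PSkip))) s1).
  apply: (@for_ind I) => //.
    exists T0 => //; split=> // p; rewrite !inE => /orP[/eqP->|pG]; first exact: connect0.
    by apply: connect1; rewrite /arc inE -surjective_pairing.
  move=> k s2 ltk xk fr [T rT [T0T sound trans]].
  have [s10 _] := st1; rewrite s10 in ltk; pose K := Ordinal ltk.
  have st2 : std n s2 by apply: std_eq st1 => j; rewrite fr.
  pose via (p : 'I_n * 'I_n) := ((p.1, K) \in T) && ((K, p.2) \in T).
  exists [set p | (p \in T) || via p].
    pose J q s' := repr s' aReach [set p | (p \in T) || ((cell p < q) && via p)].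
    have inner : J (n * n) (den (PFor2 iFrom iTo (PIf (eand (ent aReach iFrom iMid)
      (ent aReach iMid iTo))
        (PWrite aReach (ecell iFrom iTo) (Const 1)) PSkip)) s2).
      apply: (@for2_ind n J) => //; first by have [] := st2.
        by apply: repr_ext rT => p; rewrite inE orbF.
      move=> c s3 xc yc fr3 r3.
      have st3 : std n s3 by apply: std_eq st2 => j; rewrite fr3.
      have x7 : s3 iMid 0 = K by rewrite fr3.
      rewrite den_if eval_and /= xc yc x7; have [_ row] := st3; rewrite !row.
      rewrite -[c.1 * n + K]/(cell (c.1, K)) -[K * n + c.2]/(cell (K, c.2)) !(repr_neq0 _ r3).
      rewrite !inE /via /= -/(via (c.1, K)) -/(via (K, c.2)).
      (* The matrix is updated in place. This is harmless: in round [K] an entry of row or column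
         [K] can become true only if it was true already. *)
      have -> : ((c.1, K) \in T) || (cell (c.1, K) < cell c) && (((c.1, K) \in T) && ((K, K) \in T))
         = ((c.1, K) \in T) by case: (_ \in T) => //=; rewrite andbF.
      have -> : ((K, c.2) \in T) || (cell (K, c.2) < cell c) && (((K, K) \in T) && ((K, c.2) \in T))
         = ((K, c.2) \in T) by case: ((K, c.2) \in T) => //=; rewrite !andbF.
      rewrite -/(via c); case: ifP => vc.
        rewrite den_write /= xc yc row -/(cell c); apply: (repr_update (b := true) _ r3) => p.
        by rewrite !inE cell_ltS; case: eqP => [->|//]; rewrite vc orbT.
      apply: repr_ext r3 => p; rewrite !inE cell_ltS; case: eqP => [->|//].
      by rewrite vc !andbF.
    by apply: repr_ext inner => p; rewrite !inE cell_lt.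
  split.
  - by apply: subset_trans T0T _; apply/subsetP=> p; rewrite inE => ->.
  - move=> p; rewrite inE => /orP[/sound//|/andP[/sound p1 /sound p2]].
    exact: connect_trans p1 p2.
  move=> m; rewrite ltnS leq_eqVlt => /predU1P[mk|ltm] i j; rewrite !inE /via /=.
    have -> : m = K by apply: val_inj.
    by do 4!case: (_ \in T).
  move=> /orP[im|/andP[ik km]] /orP[mj|/andP[mk kj]].
  - by rewrite (trans _ ltm _ _ im mj).
  - by rewrite (trans _ ltm _ _ im mk) kj orbT.
  - by rewrite ik (trans _ ltm _ _ km mj) orbT.
  - by rewrite ik kj orbT.
have [s10 _] := st1; rewrite s10 in loop; have [T rT [T0T sound trans]] := loop.
apply: repr_ext rT => -[i j]; rewrite !inE; apply/idP/idP=> [/sound//|].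
case/connectP=> p; elim: p i => [|k p IHp] i /=.
  by move=> _ ->; apply: (subsetP T0T); rewrite inE /= eqxx.
move=> /andP[ik pp] lj; apply: (trans k) (IHp k pp lj); first exact: ltn_ord.
by apply: (subsetP T0T); move: ik; rewrite /arc !inE /= => ->; rewrite orbT.
Qed.

Lemma eval_ent n s a x y (c : 'I_n * 'I_n) P : std n s -> s x 0 = c.1 -> s y 0 = c.2 ->
  repr s a P -> (eval s (ent a x y) != 0) = (c \in P).
Proof.
move=> st xc yc /repr_neq0 <-; rewrite -[eval _ _]/(s a (eval s (ecell x y))).
by rewrite (eval_cell st xc yc); case: (c).
Qed.

Definition consider :=
  closure;;
  PAny2 fClash iTail iHead (eand (ent aCand iTail iHead) (ent aAdj iTail iHead));;
  PCount2 vCard iTail iHead (ent aCand iTail iHead);;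
  PCount2 vConn iTail iHead (ent aReach iTail iHead);;
  PIf (eand (enot (var fClash))
      (eand (enot (Sub (var vCard) (Read 0 (Const 1)))) (Sub (var vConn) (var vBest))))
    (PWrite vBest (Const 0) (var vConn);; PFill aBest iTail iHead (ent aCand iTail iHead)) PSkip.

Section Candidates.

Variables (n B : nat) (E : {set 'I_n * 'I_n}).
Implicit Types (s : store) (N M : {set 'I_n * 'I_n}).

(** With an inequality instead of an equality the invariant holds from the start, with value 0 and
    the empty set, before anything has been evaluated. *)
Definition best s := s 0 1 = B /\ exists N,
  [/\ repr s aBest N, feasible E B N & s vBest 0 <= connectivity (E :|: N)].

Lemma best_eq s s' : (forall a j, a \in [:: 0; aBest; vBest] -> s' a j = s a j) ->
  best s -> best s'.
Proof.
move=> eq [B0 [N [rN fN le]]]; split; first by rewrite eq.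
by exists N; split=> //; [apply: repr_eq rN => j; rewrite eq | rewrite eq].
Qed.

Lemma best_frame q s : all [predC mods q] [:: 0; aBest; vBest] -> best s -> best (den q s).
Proof.
by move=> /allP nq; apply: best_eq => a j /nq; apply: frame.
Qed.

Lemma consider_spec s M : std n s -> repr s aAdj E -> repr s aCand M -> best s ->
  [/\ best (den consider s), s vBest 0 <= den consider s vBest 0
    & feasible E B M -> connectivity (E :|: M) <= den consider s vBest 0].
Proof.
move=> st rE rM bs; rewrite den_seq.
have fr0 a j : a \notin mods closure -> den closure s a j = s a j by apply: frame.
have r1 := closure_spec st rE rM.
have {fr0} [st1 rE1 rM1 bs1 b1] : [/\ std n (den closure s), repr (den closure s) aAdj E,
    repr (den closure s) aCand M, best (den closure s) & den closure s vBest 0 = s vBest 0].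
  split; [exact: std_frame | exact: repr_frame | exact: repr_frame
         | exact: best_frame | exact: frame].
rewrite -{}b1; move: (den closure s) r1 st1 rE1 rM1 bs1 => {st rE rM bs} s1 rR st rE rM bs.
rewrite den_seq; set e1 := eand (ent aCand iTail iHead) _; have [n0 _] := st.
have bad : den (PAny2 fClash iTail iHead e1) s1 fClash 0 = ~~ (M \subset ~: E).
  rewrite (@any2_spec n fClash iTail iHead e1 (fun c => (c \in M) && (c \in E))) //.
    congr nat_of_bool; apply/existsP/subsetPn=> [[c /andP[cM cE]]|[c cM]].
      by exists c; rewrite // in_setC negbK.
    by rewrite in_setC negbK => cE; exists c; rewrite cM.
  move=> c s' xc yc fr; have st' : std n s' by apply: std_eq st => j; rewrite fr.
  have rM' : repr s' aCand M by apply: repr_eq rM => j; rewrite fr.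
  have rE' : repr s' aAdj E by apply: repr_eq rE => j; rewrite fr.
  by rewrite /e1 eval_and (eval_ent st' xc yc rM') (eval_ent st' xc yc rE').
set s2 := den (PAny2 fClash iTail iHead e1) s1 in bad *.
have fr2 a j : a \notin [:: iTail; iHead; fClash] -> s2 a j = s1 a j.
  by rewrite !inE !negb_or => /and3P[? ? ?]; apply: frame; rewrite !inE !negb_or; apply/and4P.
move: s2 bad fr2 => s2 bad fr2 {e1}.
have {}st : std n s2 by apply: std_eq st => j; rewrite fr2.
rewrite den_seq; set p3 := PCount2 vCard iTail iHead _; have [n2 _] := st.
have {}rM : repr s2 aCand M by apply: repr_eq rM => j; rewrite fr2.
have {}rR : repr s2 aReach [set p | connect (arc (E :|: M)) p.1 p.2].
  by apply: repr_eq rR => j; rewrite fr2.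
have card : den p3 s2 vCard 0 = #|M|.
  rewrite (@count2_spec n vCard iTail iHead _ (fun c => c \in M)) // => c s' xc yc fr.
  have st' : std n s' by apply: std_eq st => j; rewrite fr.
  by apply: (eval_ent st' xc yc); apply: repr_eq rM => j; rewrite fr.
have fr3 a j : a \notin [:: iTail; iHead; vCard] -> den p3 s2 a j = s2 a j.
  by rewrite !inE !negb_or => /and3P[? ? ?]; apply: frame; rewrite !inE !negb_or; apply/and4P.
move: (den p3 s2) card fr3 => s3 card fr3 {p3}.
have {}st : std n s3 by apply: std_eq st => j; rewrite fr3.
rewrite den_seq; set p4 := PCount2 vConn iTail iHead _; have [n3 _] := st.
have {}rM : repr s3 aCand M by apply: repr_eq rM => j; rewrite fr3.
have {}rR : repr s3 aReach [set p | connect (arc (E :|: M)) p.1 p.2].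
  by apply: repr_eq rR => j; rewrite fr3.
have conn : den p4 s3 vConn 0 = connectivity (E :|: M).
  rewrite (@count2_spec n vConn iTail iHead _ (mem [set p | connect (arc (E :|: M)) p.1 p.2])) //.
  move=> c s' xc yc fr; have st' : std n s' by apply: std_eq st => j; rewrite fr.
  by apply: (eval_ent st' xc yc); apply: repr_eq rR => j; rewrite fr.
have fr4 a j : a \notin [:: iTail; iHead; vConn] -> den p4 s3 a j = s3 a j.
  by rewrite !inE !negb_or => /and3P[? ? ?]; apply: frame; rewrite !inE !negb_or; apply/and4P.
move: (den p4 s3) conn fr4 => s4 conn fr4 {p4}.
have {}st : std n s4 by apply: std_eq st => j; rewrite fr4.
have {}rM : repr s4 aCand M by apply: repr_eq rM => j; rewrite fr4.
have fr14 a j : a \notin [:: iTail; iHead; fClash; vCard; vConn] -> s4 a j = s1 a j.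
  by rewrite !inE !negb_or => /and5P[*]; rewrite fr4 ?fr3 ?fr2 // !inE !negb_or; apply/and3P.
have bs4 : best s4.
  by apply: best_eq bs => a j; rewrite !inE => /or3P[]/eqP->; rewrite fr14.
have [B4 [N [rN fN leN]]] := bs4.
have test : (eval s4 (eand (enot (var fClash))
      (eand (enot (Sub (var vCard) (Read 0 (Const 1)))) (Sub (var vConn) (var vBest)))) != 0)
    = feasible E B M && (s1 vBest 0 < connectivity (E :|: M)).
  rewrite !eval_and !eval_not /= B4 conn fr4 // fr3 // bad fr4 // card (fr14 vBest) //.
  rewrite subn_eq0 subn_eq0 -ltnNge andbA /feasible; congr (_ && _ && _).
  by case: (_ \subset _).
rewrite den_if test; case: ifP => [/andP[fM lt]|nf].
  rewrite den_seq den_write /= conn; set s5 := update _ _ _ _.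
  have st5 : std n s5 by apply: std_eq st => j; rewrite /s5 update_neq.
  have rM5 : repr (den (PFill aBest iTail iHead (ent aCand iTail iHead)) s5) aBest M.
    apply: repr_ext (@fill_spec n aBest iTail iHead _ (fun c => c \in M) s5 isT st5 isT isT _).
      by move=> c; rewrite inE.
    move=> c s' xc yc fr; have st' : std n s' by apply: std_eq st5 => j; rewrite fr.
    by apply: (eval_ent st' xc yc); apply: repr_eq rM => j; rewrite fr.
  rewrite frame // /s5 update_eq eqxx; split; [split | exact: ltnW |] => //.
    by rewrite frame // /s5 update_neq.
  by exists M; split=> //; rewrite frame // /s5 update_eq eqxx.
rewrite /den (fr14 vBest) //; split=> // fM.
by move: nf; rewrite fM /= => /negbT; rewrite -leqNgt.
Qed.

End Candidates.

(** * The augmentation program *)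

(* Raises [fEntered] when an arc enters [y] and [fLeft] when an arc leaves [x]. *)
Definition degree_tests x y :=
  PAny fEntered iScan (Add (ent aAdj iScan y) (ent aCand iScan y));;
  PAny fLeft iScan (Add (ent aAdj x iScan) (ent aCand x iScan)).

Definition greedy :=
  PFill aCand iSink iSource (Const 0);;
  PFor2 iSink iSource (closure;; degree_tests iSink iSource;;
    PIf (eand (enot (var fEntered)) (eand (enot (var fLeft)) (enot (ent aReach iSource iSink))))
      (PWrite aCand (ecell iSink iSource) (Const 1)) PSkip).

Definition collect e num list v :=
  PIf e (PWrite list (var num) (var v);; PWrite num (Const 0) (Add (var num) (Const 1))) PSkip.

Definition list_ends :=
  PWrite vSources (Const 0) (Const 0);; PWrite vSinks (Const 0) (Const 0);;
  PFor iEnd 0 (degree_tests iEnd iEnd;;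
    collect (enot (var fEntered)) vSources aSources iEnd;;
      collect (enot (var fLeft)) vSinks aSinks iEnd).

(** Beyond the end of the shorter list its entry 0 is used. The loop runs to the number of vertices,
    not to the length of the longer list, so that its bound is an input that is never written. *)
Definition cover_ends :=
  PFor iEnd 0 (PIf (Add (Sub (var vSources) (var iEnd)) (Sub (var vSinks) (var iEnd)))
    (PIf (Sub (var vSources) (var iEnd))
       (PWrite vSource (Const 0) (Read aSources (var iEnd))) (PWrite vSource (Const 0)
         (Read aSources (Const 0)));;
     PIf (Sub (var vSinks) (var iEnd))
       (PWrite vSink (Const 0) (Read aSinks (var iEnd))) (PWrite vSink (Const 0)
         (Read aSinks (Const 0)));;
     PWrite aCand (ecell vSink vSource) (Const 1)) PSkip).

Definition augment := greedy;; list_ends;; cover_ends.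

Section Augment.

Variables (n : nat) (E : {set 'I_n * 'I_n}).
Implicit Types (s : store) (M N : {set 'I_n * 'I_n}) (u v : 'I_n).

Notation src M := (sources (E :|: M) setT).
Notation snk M := (sinks (E :|: M) setT).

Lemma degree_tests_spec s M x y u v : std n s -> repr s aAdj E -> repr s aCand M ->
  x \notin [:: iScan; fEntered; fLeft] -> y \notin [:: iScan; fEntered; fLeft] -> s x 0 = u ->
    s y 0 = v ->
  let s' := den (degree_tests x y) s in
  s' fEntered 0 = (v \notin src M) /\ s' fLeft 0 = (u \notin snk M).
Proof.
move=> st rE rM; rewrite !inE !negb_or => /and3P[x15 x16 x17] /and3P[y15 y16 y17] xu yv.
have [n0 _] := st; rewrite /= den_seq; set p := PAny fEntered iScan _; set q := PAny fLeft iScan _.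
have fr a j : a \notin [:: iScan; fEntered] -> den p s a j = s a j.
  by rewrite !inE !negb_or => /andP[? ?]; apply: frame; rewrite !inE !negb_or; apply/and3P.
have st1 : std n (den p s) by apply: std_frame st.
split.
  rewrite frame // (@any_spec n fEntered iScan _ (fun l => (l, v) \in E :|: M)) //.
    congr nat_of_bool; rewrite ?inE /= negb_forall; apply: eq_existsb => l.
    by rewrite negbK.
  move=> l s' xl fr'; have st' : std n s' by apply: std_eq st => j; rewrite fr'.
  have yv' : s' y 0 = (l, v).2 by rewrite fr' // !inE negb_or y15.
  have rE' : repr s' aAdj E by apply: repr_eq rE => j; rewrite fr'.
  have rM' : repr s' aCand M by apply: repr_eq rM => j; rewrite fr'.
  by rewrite eval_or (eval_ent (c := (l, v)) st' xl yv' rE') (eval_ent (c := (l,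
    v)) st' xl yv' rM') inE.
rewrite (@any_spec n fLeft iScan _ (fun l => (u, l) \in E :|: M)) //.
- congr nat_of_bool; rewrite ?inE /= negb_forall; apply: eq_existsb => l.
  by rewrite negbK.
- by rewrite fr.
move=> l s' xl fr'; have st' : std n s' by apply: std_eq st1 => j; rewrite fr'.
have xu' : s' x 0 = (u, l).1 by rewrite fr' ?fr // !inE negb_or x15.
have rE' : repr s' aAdj E by apply: repr_eq rE => j; rewrite fr' ?fr.
have rM' : repr s' aCand M by apply: repr_eq rM => j; rewrite fr' ?fr.
by rewrite eval_or (eval_ent (c := (u, l)) st' xu' xl rE') (eval_ent (c := (u,
  l)) st' xu' xl rM') inE.
Qed.

Definition linkable M (c : 'I_n * 'I_n) :=
  [&& c.2 \in src M, c.1 \in snk M & ~~ connect (arc (E :|: M)) c.2 c.1].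

(** The two inequalities are the account of the greedy phase: every new arc is paid for by one
    source and by one sink. *)
Definition partial_augmentation M := [/\ M \subset ~: E, acyclic (E :|: M),
  #|M| + #|src M| <= #|src set0| & #|M| + #|snk M| <= #|snk set0|].

(** Adding arcs never makes a pair linkable, so a single pass over all pairs reaches the terminal
    situation. *)
Lemma linkable_add1 M c c' : linkable (c |: M) c' -> linkable M c'.
Proof.
case: c => b a; rewrite /linkable setUCA sources_add1 sinks_add1 !inE.
case/and3P=> /andP[_ ->] /andP[_ ->] nc; apply: contraNN nc.
by apply: sub_connect_arc; apply: subsetUr.
Qed.

Lemma link_partial M c : linkable M c -> partial_augmentation M ->
  partial_augmentation (c |: M).
Proof.
case: c => b a /and3P[/= as_ bs nab] [ME acM csrc csnk].
have [_ nb] := sinksP _ _ _ bs; split.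
- rewrite subUset ME andbT; apply/subsetP=> p /set1P->; rewrite inE.
  by have:= nb a; rewrite inE negb_or => /andP[].
- by rewrite setUCA; apply: acyclic_add1.
- move: csrc; rewrite setUCA sources_add1 (cardsD1 a (src M)) as_ cardsU1.
  apply: leq_trans; rewrite addnCA addnA; apply: leq_add (leqnn _).
  by apply: leq_add (leqnn _); apply: leq_b1.
- move: csnk; rewrite setUCA sinks_add1 (cardsD1 b (snk M)) bs cardsU1.
  apply: leq_trans; rewrite addnCA addnA; apply: leq_add (leqnn _).
  by apply: leq_add (leqnn _); apply: leq_b1.
Qed.

Lemma greedy_spec s : acyclic E -> std n s -> repr s aAdj E ->
  exists M, [/\ repr (den greedy s) aCand M, partial_augmentation M
    & forall c, ~~ linkable M c].
Proof.
move=> acE st rE; rewrite den_seq.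
have r0 : repr (den (PFill aCand iSink iSource (Const 0)) s) aCand (set0 : {set 'I_n * 'I_n}).
  have r0 := @fill_spec n aCand iSink iSource (Const 0) xpred0 s isT st isT isT (fun _ _ _ _ _ => erefl).
  by move=> c; rewrite r0 !inE.
have st1 := @std_frame n (PFill aCand iSink iSource (Const 0)) s isT isT st.
have rE1 := @repr_frame n (PFill aCand iSink iSource (Const 0)) s aAdj E isT rE.
move: (den (PFill aCand iSink iSource (Const 0)) s) st1 rE1 r0 => {st rE} s st rE r0.
set body := (closure;; _).
pose I q s' := exists M, [/\ repr s' aCand M, partial_augmentation M
  & forall c, cell c < q -> ~~ linkable M c].
suff [M [? ? lM]] : I (n * n) (den (PFor2 iSink iSource body) s).
  by exists M; split=> // c; apply: lM; apply: cell_lt.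
apply: (@for2_ind n I) => //; first by have [] := st.
  by exists set0; split=> //; split; rewrite ?sub0set ?cards0 // setU0.
move=> [b a] s1 xb ya fr [M [rM pM lM]].
have {}st : std n s1 by apply: std_eq st => j; rewrite fr.
have {}rE : repr s1 aAdj E by apply: repr_eq rE => j; rewrite fr.
rewrite /body 2!den_seq.
have rR := closure_spec st rE rM.
have st2 := @std_frame n closure s1 isT isT st.
have rE2 := @repr_frame n closure s1 aAdj E isT rE.
have rM2 := @repr_frame n closure s1 aCand M isT rM.
have xb2 : den closure s1 iSink 0 = b by rewrite frame.
have ya2 : den closure s1 iSource 0 = a by rewrite frame.
move: (den closure s1) rR st2 rE2 rM2 xb2 ya2 => s2 rR st2 rE2 rM2 xb2 ya2.
have [] := degree_tests_spec (x := iSink) (y := iSource) st2 rE2 rM2 isT isT xb2 ya2.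
set p := degree_tests iSink iSource; have fr3 z j : z \notin mods p ->
  den p s2 z j = s2 z j by apply: frame.
move: (den p s2) fr3 => s3 fr3 t16 t17.
have st3 : std n s3 by apply: std_eq st2 => j; rewrite fr3.
have rM3 : repr s3 aCand M by apply: repr_eq rM2 => j; rewrite fr3.
have rR3 : repr s3 aReach [set p | connect (arc (E :|: M)) p.1 p.2].
  by apply: repr_eq rR => j; rewrite fr3.
have ya3 : s3 iSource 0 = (a, b).1 by rewrite fr3.
have xb3 : s3 iSink 0 = (a, b).2 by rewrite fr3.
have test : (eval s3 (eand (enot (var fEntered)) (eand (enot (var fLeft))
  (enot (ent aReach iSource iSink)))) != 0)
    = linkable M (b, a).
  rewrite !eval_and !eval_not -[eval _ (ent aReach _ _) == 0]negbK.
  rewrite (eval_ent (c := (a, b)) st3 ya3 xb3 rR3) /= t16 t17 [(_, _) \in [set _ | _]]inE /=.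
  by rewrite /linkable /=; case: (a \in _); case: (b \in _).
rewrite den_if test.
case: ifP => lk.
  exists ((b, a) |: M); split; last 1 first.
  - move=> c; rewrite cell_ltS => /predU1P[->|ltc].
      by rewrite /linkable setUCA sources_add1 !inE eqxx.
    by apply: contra (lM c ltc); apply: linkable_add1.
  - rewrite den_write (@eval_cell n s3 iSink iSource b a) //.
    by apply: (repr_update (b := true) _ rM3) => c; rewrite !inE; case: eqP.
  exact: link_partial.
exists M; split=> // c; rewrite cell_ltS => /predU1P[->|]; [by rewrite lk | exact: lM].
Qed.

(* [A] is enumerated by the first entries of [list], as many as [num] tells. *)
Definition listed num list (A : {set 'I_n}) s :=
  [/\ s num 0 <= #|A|, {in A, forall u, exists2 j, j < s num 0 & s list j = u}
    & forall j, j < s num 0 -> exists2 u, u \in A & s list j = u].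

Lemma listed_eq num list A s s' : (forall j, s' num j = s num j) ->
  (forall j, s' list j = s list j) -> listed num list A s -> listed num list A s'.
Proof.
move=> en el [c i o]; split; rewrite ?en //.
  by move=> u /i[j lt ju]; exists j; rewrite ?en ?el.
by move=> j /o[u uA ju]; exists u; rewrite ?el.
Qed.

Lemma collect_spec e (num list x : nat) s (A : {set 'I_n}) u : num != list ->
  s x 0 = u -> u \notin A -> listed num list A s ->
  listed num list (if eval s e != 0 then u |: A else A) (den (collect e num list x) s).
Proof.
move=> nl vu uA [c i o]; rewrite /collect den_if; case: ifP => // _.
rewrite den_seq !den_write /= update_neq 1?eq_sym // vu.
set s' := update _ num _ _.
have en : s' num 0 = (s num 0).+1 by rewrite /s' update_eq eqxx addn1.
have el j : s' list j = if j == s num 0 then val u else s list j.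
  by rewrite /s' update_neq // update_eq.
split; rewrite en.
- by rewrite cardsU1 uA add1n ltnS.
- move=> w /setU1P[->|/i[j ltj jw]]; first by exists (s num 0); rewrite // el eqxx.
  by exists j; [rewrite ltnS ltnW | rewrite el ltn_eqF].
move=> j; rewrite ltnS leq_eqVlt el => /predU1P[->|ltj].
  by exists u; rewrite ?eqxx ?setU11.
by have [w wA jw] := o j ltj; exists w; [rewrite setU1r | rewrite ltn_eqF].
Qed.

Lemma listed_set0 num list s : s num 0 = 0 -> listed num list set0 s.
Proof. by move=> n0; split; rewrite n0 // => u; rewrite inE. Qed.

Definition upto i (A : {set 'I_n}) := [set u in A | u < i].

Lemma upto_full A : upto n A = A.
Proof. by apply/setP=> u; rewrite inE ltn_ord andbT. Qed.

Lemma uptoS u A : upto u.+1 A = if u \in A then u |: upto u A else upto u A.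
Proof.
have ltS w : (w < u.+1) = (w == u) || (w < u) by rewrite ltnS leq_eqVlt.
by case: ifP => uA; apply/setP=> w; rewrite !inE ltS -?val_eqE /=;
  case: eqP => [/val_inj->|] //=; rewrite uA.
Qed.

Lemma list_ends_spec s M : std n s -> repr s aAdj E -> repr s aCand M ->
  listed vSources aSources (src M) (den list_ends s) /\ listed vSinks aSinks (snk M)
    (den list_ends s).
Proof.
move=> st rE rM; rewrite /list_ends den_seq; set s1 := den _ s.
rewrite den_seq; set s2 := den _ s1; set loop := PFor _ _ _.
have fr2 a j : a \notin [:: vSources; vSinks] -> s2 a j = s a j.
  by rewrite !inE negb_or => /andP[? ?]; rewrite /s2 frame ?inE // /s1 frame ?inE.
have st2 : std n s2 by apply: std_eq st => j; rewrite fr2.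
pose I i s' := listed vSources aSources (upto i (src M)) s' /\ listed vSinks aSinks (upto i (snk M)) s'.
suff : I (s2 0 0) (den loop s2).
  by have [-> _] := st2; rewrite /I !upto_full.
apply: (@for_ind I) => //.
  have u0 A : upto 0 A = set0 by apply/setP=> u; rewrite !inE andbF.
  by rewrite /I !u0; split; apply: listed_set0.
move=> i s3; have [n2 _] := st2; rewrite n2 => lti vi fr3 [l1 l2].
have st3 : std n s3 by apply: std_eq st2 => j; rewrite fr3.
have rE3 : repr s3 aAdj E by apply: repr_eq rE => j; rewrite fr3 // fr2.
have rM3 : repr s3 aCand M by apply: repr_eq rM => j; rewrite fr3 // fr2.
pose u := Ordinal lti; have vu : s3 iEnd 0 = u by [].
have [] := degree_tests_spec (x := iEnd) (y := iEnd) st3 rE3 rM3 isT isT vu vu.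
rewrite den_seq; set p := degree_tests iEnd iEnd.
have fr4 z j : z \notin mods p -> den p s3 z j = s3 z j by apply: frame.
move: (den p s3) fr4 => s4 fr4 t16 t17.
have {}l1 : listed vSources aSources (upto u (src M)) s4 by apply: listed_eq l1 => j; rewrite fr4.
have {}l2 : listed vSinks aSinks (upto u (snk M)) s4 by apply: listed_eq l2 => j; rewrite fr4.
have {}vu : s4 iEnd 0 = u by rewrite fr4.
have nu A : u \notin upto u A by rewrite inE ltnn andbF.
rewrite den_seq; set c1 := collect _ vSources aSources iEnd; set c2 := collect _ vSinks aSinks iEnd.
have := @collect_spec (enot (var fEntered)) vSources aSources iEnd s4 _ u isT vu (nu _) l1.
rewrite -/c1 => l1'; have {}l2 : listed vSinks aSinks (upto u (snk M)) (den c1 s4).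
  by apply: listed_eq l2 => j; rewrite frame.
have vu' : den c1 s4 iEnd 0 = u by rewrite frame.
have := @collect_spec (enot (var fLeft)) vSinks aSinks iEnd (den c1 s4) _ u isT vu' (nu _) l2.
rewrite -/c2 => l2'; split.
  have {}l1' : listed vSources aSources (upto u.+1 (src M)) (den c1 s4).
    by rewrite uptoS; move: l1'; rewrite eval_not /= t16; case: (u \in src M).
  by apply: listed_eq l1' => j; rewrite frame.
have : listed vSinks aSinks (upto u.+1 (snk M)) (den c2 (den c1 s4)); last by [].
by rewrite uptoS; move: l2'; rewrite eval_not /= frame // t17; case: (u \in snk M).
Qed.

Definition pick_entry (s : store) num list j := s list (if j < s num 0 then j else 0).

Lemma pick_entry_in num list A s j : listed num list A s -> 0 < s num 0 ->
  exists2 u, u \in A & pick_entry s num list j = u.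
Proof. by case=> _ _ o s0; apply: o; case: ifP. Qed.

(** The third clause is kept in order to show later that the new arcs avoid [E]: those not in [M]
    leave a sink. *)
Lemma cover_ends_spec s M : std n s -> repr s aCand M -> acyclic (E :|: M) ->
  (forall c, ~~ linkable M c) -> listed vSources aSources (src M) s ->
    listed vSinks aSinks (snk M) s ->
  exists N, [/\ repr (den cover_ends s) aCand N, M \subset N,
    forall b a, (b, a) \in N -> ((b, a) \in M) || (b \in snk M),
    #|N| <= #|M| + maxn #|src M| #|snk M|
    & forall x y, connect (arc (E :|: N)) x y].
Proof.
move=> st rM acM nlk L1 L2; have [c1 i1 _] := L1; have [c2 i2 _] := L2.
have subT : E :|: M \subset within setT by apply/subsetP=> p; rewrite !inE.
pose sa := pick_entry s vSources aSources; pose sb := pick_entry s vSinks aSinks.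
pose act j := (j < s vSources 0) || (j < s vSinks 0).
(* A vertex of an acyclic graph is reached from a source and reaches a sink, so if one list is
   nonempty then so is the other, and entry 0 is meaningful. *)
have ends j : act j -> 0 < s vSources 0 /\ 0 < s vSinks 0.
  have to0 b : b \in snk M -> 0 < s vSources 0.
    move=> bs; have [a as_ _] := exists_source subT acM (in_setT b).
    by have [k ltk _] := i1 a as_; apply: leq_trans ltk.
  have to1 a : a \in src M -> 0 < s vSinks 0.
    move=> as_; have [b bs _] := exists_sink subT acM (in_setT a).
    by have [k ltk _] := i2 b bs; apply: leq_trans ltk.
  have [_ _ o1] := L1; have [_ _ o2] := L2.
  case/orP=> lt; split; try exact: leq_trans lt.
    by have [a as_ _] := o1 _ lt; apply: to1 as_.
  by have [b bs _] := o2 _ lt; apply: to0 bs.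
pose I i s' := exists N, [/\ repr s' aCand N, M \subset N,
  forall b a, (b, a) \in N -> ((b, a) \in M) || (b \in snk M),
  #|N| <= #|M| + minn i (maxn (s vSources 0) (s vSinks 0))
  & forall j (a b : 'I_n), j < i -> act j -> sa j = a -> sb j = b -> (b, a) \in N].
have : I (s 0 0) (den cover_ends s).
  apply: (@for_ind I) => //.
    by exists M; split=> // [b a ->//|]; rewrite ?min0n ?addn0.
  move=> i s1; have [n0 _] := st; rewrite n0 => lti vi fr [N [rN MN tN cN iN]].
  have st1 : std n s1 by apply: std_eq st => j; rewrite fr.
  rewrite den_if; set test := (_ != 0); have -> : test = act i.
    by rewrite /test eval_or /= vi !fr // !subn_eq0 -!ltnNge.
  case: ifP => [ai|nai]; last first.
    exists N; split=> //.
      by apply: leq_trans cN _; rewrite leq_add2l; move: nai; rewrite /act; lia.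
    by move=> j a b; rewrite ltnS leq_eqVlt => /predU1P[->|]; [rewrite nai | apply: iN].
  have [s0 s0'] := ends i ai.
  have [a as_ ia] := pick_entry_in i L1 s0; have [b bs ib] := pick_entry_in i L2 s0'.
  rewrite 2!den_seq; set p := PIf (Sub (var vSources) _) _ _; set q := PIf (Sub (var vSinks) _) _ _.
  have pa : den p s1 vSource 0 = a.
    rewrite -ia /pick_entry /p den_if !den_write /= vi !fr // subn_eq0 -ltnNge.
    by case: ifP; rewrite update_eq eqxx.
  have qb : den q (den p s1) vSink 0 = b.
    rewrite -ib /pick_entry /q den_if !den_write /= !frame // vi !fr // subn_eq0 -ltnNge.
    by case: ifP; rewrite update_eq eqxx // frame // ?fr // vi.
  have qa : den q (den p s1) vSource 0 = a by rewrite frame.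
  have rN' : repr (den q (den p s1)) aCand N.
    by apply: repr_eq rN => j; rewrite !frame.
  have st' : std n (den q (den p s1)) by apply: std_eq st1 => j; rewrite !frame.
  rewrite den_write (@eval_cell n _ vSink vSource b a) //=.
  exists ((b, a) |: N); split.
  - by apply: (repr_update (b := true) _ rN') => c; rewrite !inE; case: eqP.
  - by apply: subset_trans MN _; apply: subsetUr.
  - move=> b' a' /setU1P[[-> _]|/tN//]; by rewrite bs orbT.
  - rewrite cardsU1; move: cN ai; rewrite /act; case: (_ \notin _) => /=; lia.
  move=> j a' b'; rewrite ltnS leq_eqVlt => /predU1P[->|ltj].
    move=> _; rewrite /sa /sb ia ib => /val_inj<- /val_inj<-; exact: setU11.
  by move=> aj ja jb; rewrite setU1r // (iN j).
have [n0 _] := st; rewrite n0 => -[N [rN MN tN cN iN]]; exists N; split=> //.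
  by apply: leq_trans cN _; rewrite leq_add2l (leq_trans (geq_minr _ _)) // geq_max
    !leq_max c1 c2 orbT.
have ltn_ends k : act k -> k < n.
  case/orP=> ltk; apply: leq_trans ltk _; rewrite -[leqRHS]card_ord.
    exact: leq_trans c1 (max_card _).
  exact: leq_trans c2 (max_card _).
move=> x y; have -> : E :|: N = E :|: M :|: N by rewrite -setUA (setUidPr MN).
apply: (strong_cover subT acM); rewrite ?inE //.
- move=> a b as_ bs; apply: contraT => nab; have:= nlk (b, a).
  by rewrite /linkable /= as_ bs nab.
- move=> b bs; have [k ltk kb] := i2 b bs; have ak : act k by rewrite /act ltk orbT.
  have [a as_ ka] := pick_entry_in k L1 (ends k ak).1.
  exists a => //; apply: (iN k); rewrite ?ltn_ends //.
  by rewrite /sb /pick_entry ltk.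
move=> a as_; have [k ltk ka] := i1 a as_; have ak : act k by rewrite /act ltk.
have [b bs kb] := pick_entry_in k L2 (ends k ak).2.
exists b => //; apply: (iN k); rewrite ?ltn_ends //.
by rewrite /sa /pick_entry ltk.
Qed.

Lemma augment_spec B s : acyclic E -> std n s -> repr s aAdj E ->
  exists N, [/\ repr (den augment s) aCand N,
    forall x y, connect (arc (E :|: N)) x y
    & #|sources E setT| <= B -> #|sinks E setT| <= B -> feasible E B N].
Proof.
move=> acE st rE; have [M [rM [ME acM csrc csnk] nlk]] := greedy_spec acE st rE.
rewrite /augment 2!den_seq.
have st1 := @std_frame n greedy s isT isT st.
have rE1 := @repr_frame n greedy s aAdj E isT rE.
move: (den greedy s) st1 rE1 rM => s1 st1 rE1 rM.
have [l1 l2] := list_ends_spec st1 rE1 rM.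
have st2 := @std_frame n list_ends s1 isT isT st1.
have rM2 := @repr_frame n list_ends s1 aCand M isT rM.
have [N [rN MN tN cN conn]] := cover_ends_spec st2 rM2 acM nlk l1 l2.
exists N; split=> // csrcB csnkB; rewrite setU0 in csrc csnk; apply/andP; split.
  apply/subsetP=> -[b a] /tN/orP[/(subsetP ME)//|/sinksP[_ /(_ a)]].
  by rewrite !inE negb_or => /andP[].
apply: leq_trans cN _; rewrite addn_maxr geq_max.
by rewrite (leq_trans csrc csrcB) (leq_trans csnk csnkB).
Qed.

End Augment.

(** * The kernel program *)

Definition mark_nonsinks :=
  PFor iVert 0 (PAny fDiffer iNbr (ent aAdj iVert iNbr);; PWrite aNonsink (var iVert)
    (var fDiffer));;
  PCount vNonsinks iVert (Read aNonsink (var iVert)).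

Definition scan_twins :=
  PWrite vTwins (Const 0) (Const 0);;
  PFor iTwin 0 (PIf
    (eand (Sub (var iVert) (var iTwin)) (eand (Read aKept (var iTwin))
       (eand (enot (Read aNonsink (var iTwin))) (enot (Read aNonsink (var iVert))))))
    (PAny fDiffer iNbr (eneq (ent aAdj iNbr iTwin) (ent aAdj iNbr iVert));;
     PIf (enot (var fDiffer))
       (PWrite vTwins (Const 0) (Add (var vTwins) (Const 1));; PWrite vRep (Const 0)
         (var iTwin)) PSkip)
    PSkip).

(** A vertex is kept provisionally and dropped if its class is already full. As the vertices come in
    increasing order, a full class never changes its largest kept vertex, which can therefore serve
    as representative at once. *)
Definition build_kernel :=
  PFill aChain iKeptTail iKeptHead (Const 0);;
  PFor iVert 0 (PWrite aKept (var iVert) (Const 1);; PWrite aLast (var iVert) (var iVert);;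
    scan_twins;;
    PIf (enot (Sub (var vQuota) (var vTwins)))
      (PWrite aKept (var iVert) (Const 0);;
       PWrite aChain (Add (Read aRow (Read aLast (var vRep))) (var iVert)) (Const 1);;
       PWrite aLast (var vRep) (var iVert)) PSkip).

Lemma notin_sub (A B : seq nat) a : all (mem B) A -> a \notin B -> a \notin A.
Proof. by move=> /allP AB; apply: contra => /AB. Qed.

Section KernelSteps.

Variables (n h : nat) (E : {set 'I_n * 'I_n}).
Implicit Types (u v w r : 'I_n) (K : {set 'I_n}) (CH : {set 'I_n * 'I_n})
  (last : 'I_n -> 'I_n).

Notation removed_via := (removed_via E h).
Notation kept_twins := (kept_twins E).
Notation twins := (twins E).

(** The state after the vertices below [i]: each of them has contributed a kept vertex or a chain
    arc, hence the bound in [pk_card]. The clause last a < i prevents a vertex kept later from being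
    the end of an existing chain. *)
Record partial_kernel (i : nat) K CH last : Prop := PartialKernel {
  pk_removed : forall v, v < i -> v \notin K -> exists r, removed_via K CH last v r;
  pk_last : {in K, forall a, connect (arc CH) a (last a)};
  pk_lastK : {in K, forall a, last a = a \/ (last a \notin K /\ last a < i)};
  pk_card : #|CH| + #|K| <= i;
  pk_tail : forall x y, (x, y) \in CH -> x \in snk E;
  pk_class : forall v, #|kept_twins K v| <= h;
  pk_prefix : {in K, forall v, v < i}
}.

Lemma partial_kernel_full K CH last : partial_kernel n K CH last -> kernel E h K CH last.
Proof.
move=> [rem la laK c t cl _]; split=> //; first by move=> v; apply: rem.
by move=> a /laK[->|[]]; [left | right].
Qed.

Lemma kept_twins_eq K v w : twins v w -> kept_twins K v = kept_twins K w.
Proof.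
move=> vw; apply/setP=> u; rewrite !inE; case: (u \in K) => //=; apply/idP/idP=> uv.
  exact: twins_trans uv vw.
exact: twins_trans uv (twins_sym vw).
Qed.

Lemma kept_twinsU1 K v w : ~~ twins v w -> kept_twins (v |: K) w = kept_twins K w.
Proof.
by move=> nvw; apply/setP=> u; rewrite !inE; case: eqP => // ->; rewrite (negbTE nvw) !andbF.
Qed.

(** A class with removed vertices is full, hence is not the class of [v], and its kept vertices stay
    the same. *)
Lemma partial_kernel_keep v K CH last last' : partial_kernel v K CH last ->
  #|kept_twins K v| < h -> {in K, last' =1 last} -> last' v = v ->
  partial_kernel v.+1 (v |: K) CH last'.
Proof.
move=> [rem la laK c t cl pre] few eql lv; have vK : v \notin K by apply/negP=> /pre; rewrite ltnn.
split=> //.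
- move=> w; rewrite ltnS leq_eqVlt !inE negb_or => lew /andP[wv wK].
  have ltw : w < v by case/orP: lew => [/eqP/val_inj wv'|//]; rewrite wv' eqxx in wv.
  have [r [rw hw rmax rw1 rw2]] := rem _ ltw wK; exists r.
  have nvw : ~~ twins v w.
    by apply: contraL few => /(kept_twins_eq K)->; rewrite -leqNgt.
  split; rewrite ?kept_twinsU1 // eql //; by move: rw; rewrite inE => /andP[].
- by move=> a /setU1P[->|aK]; rewrite ?lv ?connect0 // eql //; apply: la.
- move=> a /setU1P[->|aK]; [by left|]; rewrite eql //.
  case: (laK a aK) => [->|[nK lt]]; [by left | right].
  by rewrite !inE negb_or nK andbT (ltn_trans lt) // -val_eqE /= ltn_eqF.
- by rewrite cardsU1 vK addnCA ltnS.
- move=> w; have [vw|nvw] := boolP (twins v w); last by rewrite kept_twinsU1.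
  rewrite (kept_twins_eq K vw) in few; apply: leq_trans few.
  apply: (@leq_trans #|v |: kept_twins K w|); last by rewrite cardsU1; case: (_ \notin _).
  by apply/subset_leq_card/subsetP=> u; rewrite !inE => /andP[/orP[->//|->] ->]; rewrite orbT.
by move=> w /setU1P[->//|/pre/leq_trans]; apply.
Qed.

(** [v] is linked behind the present end of the chain of [r] and becomes the new end; walks to the
    old end are prolonged by the new arc. *)
Lemma partial_kernel_drop v r K CH last last' : partial_kernel v K CH last ->
  h <= #|kept_twins K v| -> r \in kept_twins K v -> {in kept_twins K v, forall u, u <= r} ->
  {in K, forall a, last' a = if a == r then v else last a} ->
  partial_kernel v.+1 K ((last r, v) |: CH) last'.
Proof.
move=> [rem la laK c t cl pre] many rv rmax el; have vK : v \notin K by apply/negP=> /pre;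
  rewrite ltnn.
have rK : r \in K by move: rv; rewrite inE => /andP[].
have sub : subrel (connect (arc CH)) (connect (arc ((last r, v) |: CH))).
  by apply: sub_connect_arc; apply: subsetUr.
have lrv : connect (arc ((last r, v) |: CH)) (last r) v.
  by apply: connect1; rewrite /arc setU11.
have er : last' r = v by rewrite el // eqxx.
split=> //.
- move=> w; rewrite ltnS leq_eqVlt => /predU1P[/val_inj->|ltw] wK.
    exists r; split; rewrite ?er ?connect0 //.
    by apply: connect_trans lrv; apply: sub; apply: la.
  have [r' [rw hw rmax' rw1 rw2]] := rem _ ltw wK; exists r'; split=> //; first exact: sub.
  rewrite el; last by move: rw; rewrite inE => /andP[].
  by case: eqP => [e|_]; [rewrite e in rw2; apply: connect_trans lrv|]; apply: sub.
- move=> a aK; rewrite el //; case: eqP => [->|_]; last by apply: sub; apply: la.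
  by apply: connect_trans lrv; apply: sub; apply: la.
- move=> a aK; rewrite el //; case: eqP => [_|_]; first by right.
  by case: (laK a aK) => [->|[nK lt]]; [left | right; rewrite ltnW].
- rewrite cardsU1; move: c; case: (_ \notin _) => /=; lia.
- move=> x y /setU1P[[-> _]|/t//].
  case: (laK r rK) => [->|[nK lt]]; first by move: rv; rewrite inE => /andP[_ /twinsP[]].
  by have [r' []] := rem _ lt nK; rewrite inE => /andP[_ /twinsP[]].
by move=> w /pre/ltnW.
Qed.

Lemma mark_nonsinks_spec s : std n s -> repr s aAdj E ->
  (forall v, den mark_nonsinks s aNonsink v = (v \notin snk E)) /\
  den mark_nonsinks s vNonsinks 0 = #|~: snk E|.
Proof.
move=> st rE; rewrite /mark_nonsinks den_seq; set p := PFor _ _ _.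
have [n0 _] := st; pose I i (s' : store) := forall v, v < i -> s' aNonsink v = (v \notin snk E).
have marks : forall v, den p s aNonsink v = (v \notin snk E).
  move=> v; suff : I (s 0 0) (den p s) by apply; rewrite n0.
  apply: (@for_ind I) => // i s1 lti vi fr IH; rewrite n0 in lti.
  have st1 : std n s1 by apply: std_eq st => j; rewrite fr.
  have rE1 : repr s1 aAdj E by apply: repr_eq rE => j; rewrite fr.
  rewrite den_seq den_write /=; set any := PAny _ _ _.
  have flag : den any s1 fDiffer 0 = [exists l, (Ordinal lti, l) \in E].
    apply: any_spec => //; first by have [] := st1.
    move=> l s2 xl fr2; apply: (eval_ent (c := (Ordinal lti, l))) => //.
    - by apply: std_eq st1 => j; rewrite fr2.
    - by rewrite /= fr2.
    by apply: repr_eq rE1 => j; rewrite fr2.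
  move=> w; rewrite ltnS leq_eqVlt update_eq frame // vi => /predU1P[wi|ltw].
    have -> : w = Ordinal lti by apply: val_inj.
    rewrite eqxx flag; congr nat_of_bool; rewrite inE in_setT /= negb_forall.
    by apply: eq_existsb => l; rewrite negbK.
  by rewrite ltn_eqF // frame // IH.
split=> [v|]; first by rewrite frame.
rewrite (@count_spec n vNonsinks iVert _ (fun v => v \in ~: snk E)) //; first by rewrite frame.
by move=> v s1 xv fr; rewrite /= xv fr // marks in_setC; case: (v \in snk E).
Qed.

(* Nothing is assumed of the later entries of [aKept]: they are left over from the first
   of the two runs. *)
Lemma scan_twins_spec s K v : std n s -> repr s aAdj E ->
  (forall u, s aNonsink u = (u \notin snk E)) -> (forall u, u < v -> s aKept u = (u \in K)) ->
  {in K, forall u, u < v} -> s iVert 0 = v ->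
  den scan_twins s vTwins 0 = #|kept_twins K v| /\
  (0 < #|kept_twins K v| -> exists r, [/\ den scan_twins s vRep 0 = r, r \in kept_twins K v
     & {in kept_twins K v, forall u, u <= r}]).
Proof.
move=> st rE ms ks pre vv; rewrite /scan_twins den_seq den_write; set s0 := update _ _ _ _.
pose T i := [set u in kept_twins K v | u < i].
pose I i (s' : store) := s' vTwins 0 = #|T i| /\
  (0 < #|T i| -> exists r, [/\ s' vRep 0 = r, r \in T i & {in T i, forall u, u <= r}]).
have st0 : std n s0 by apply: std_eq st => j; rewrite /s0 update_neq.
set loop := PFor _ _ _; suff : I (s0 0 0) (den loop s0).
  have [-> _] := st0; rewrite /I; suff -> : T n = kept_twins K v by [].
  by apply/setP=> u; rewrite inE ltn_ord andbT.
have fr0 a j : a != vTwins -> s0 a j = s a j by move=> na; rewrite /s0 update_neq // eq_sym.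
apply: (@for_ind I) => //.
  have T0 : T 0 = set0 by apply/setP=> u; rewrite !inE andbF.
  by rewrite /I T0 cards0 /s0 update_eq.
move=> i s1; have [-> _] := st0 => lti ui fr [cnt last].
pose u := Ordinal lti.
have st1 : std n s1 by apply: std_eq st0 => j; rewrite fr.
have rE1 : repr s1 aAdj E by apply: repr_eq rE => j; rewrite fr // fr0.
have TS : T i.+1 = if u \in kept_twins K v then u |: T i else T i.
  apply/setP=> w; have ltS : (w < i.+1) = (w == u) || (w < i) by rewrite ltnS leq_eqVlt.
  rewrite [LHS]in_set ltS; case: ifP => uT; rewrite ?in_setU1 [w \in T i]in_set;
    by case: eqP => [->|_] //=; rewrite uT.
have v1 : s1 iVert 0 = v by rewrite fr // fr0.
have test : (eval s1 (eand (Sub (var iVert) (var iTwin)) (eand (Read aKept (var iTwin))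
    (eand (enot (Read aNonsink (var iTwin))) (enot (Read aNonsink (var iVert)))))) != 0)
    = [&& u \in K, u \in snk E & v \in snk E].
  rewrite !eval_and !eval_not /= ui v1 !fr // !fr0 // -[i]/(nat_of_ord u) !ms subn_eq0 -ltnNge.
  case: (ltnP u v) => [ltuv|levu]; first by rewrite (ks _ ltuv); do 3!case: (_ \in _).
  by case: (boolP (u \in K)) => // /pre; rewrite ltnNge levu.
rewrite den_if test.
have keepI s' : s' vTwins 0 = s1 vTwins 0 -> s' vRep 0 = s1 vRep 0 -> u \notin kept_twins K v ->
  I i.+1 s'.
  by move=> e35 e36 /negbTE nuT; rewrite /I TS nuT e35 e36.
case: ifP => [/and3P[uK us vs]|nT]; last first.
  apply: keepI => //; rewrite inE; apply: contraFN nT => /andP[-> /twinsP[-> -> _]] //.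
rewrite den_seq; set any := PAny _ _ _.
have flag : den any s1 fDiffer 0 = (u \notin kept_twins K v).
  rewrite (@any_spec n fDiffer iNbr _ (fun l => ((l, u) \in E) != ((l, v) \in E))) //.
  - congr nat_of_bool; rewrite !inE uK /= -/(snk E) /twins us vs /= negb_forall.
    by apply: eq_existsb.
  - by have [] := st1.
  move=> l s2 xl fr2; rewrite eval_neq.
  have st2 : std n s2 by apply: std_eq st1 => j; rewrite fr2.
  have rE2 : repr s2 aAdj E by apply: repr_eq rE1 => j; rewrite fr2.
  have u2 : s2 iTwin 0 = u by rewrite fr2.
  have v2 : s2 iVert 0 = v by rewrite fr2.
  rewrite -[eval _ (ent _ iNbr iTwin)]/(s2 aAdj (eval s2 (ecell iNbr iTwin))).
  rewrite -[eval _ (ent _ iNbr iVert)]/(s2 aAdj (eval s2 (ecell iNbr iVert))).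
  rewrite (eval_cell st2 xl u2) (eval_cell st2 xl v2) !rE2.
  by case: (_ \in E); case: (_ \in E).
rewrite den_if eval_not /= flag; case: ifP => [uT|nuT].
  have {}uT : u \in kept_twins K v by move: uT; case: (_ \in _).
  have unT : u \notin T i by rewrite inE ltnn andbF.
  rewrite den_seq !den_write /I TS uT; split.
    by rewrite update_neq // update_eq eqxx /= frame // cnt cardsU1 unT addn1.
  move=> _; exists u; split; rewrite ?setU11 //.
    by rewrite update_eq eqxx /= update_neq // frame.
  by move=> w /setU1P[->//|]; rewrite inE => /andP[_ /ltnW].
by apply: keepI; rewrite ?frame //; move: nuT; case: (_ \in _).
Qed.

Lemma build_kernel_spec s : 0 < h -> std n s -> repr s aAdj E ->
  (forall u, s aNonsink u = (u \notin snk E)) -> s vQuota 0 = h ->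
  exists K CH last, [/\ kernel E h K CH last, repr (den build_kernel s) aChain CH,
    forall u, den build_kernel s aKept u = (u \in K)
    & {in K, forall a : 'I_n, den build_kernel s aLast a = last a}].
Proof.
move=> h0 st rE ms hs; rewrite /build_kernel den_seq; set s0 := den _ s.
have st0 : std n s0 by apply: std_frame st.
pose I i (s' : store) := exists K CH last, [/\ partial_kernel i K CH last, repr s' aChain CH,
  forall u, u < i -> s' aKept u = (u \in K) & {in K, forall a : 'I_n, s' aLast a = last a}].
set loop := PFor _ _ _; suff : I (s0 0 0) (den loop s0).
  have [-> _] := st0 => -[K [CH [last [pk rC kK kl]]]].
  by exists K, CH, last; split=> //; [apply: partial_kernel_full | move=> u; apply: kK].
apply: (@for_ind I) => //.
  exists set0, set0, id; split=> //.
  - split=> //; rewrite ?cards0 //; try by [move=> a; rewrite inE | move=> x y; rewrite inE].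
    by move=> v; rewrite (_ : kept_twins _ _ = set0) ?cards0 //; apply/setP=> u; rewrite !inE.
  - have r0 := @fill_spec n aChain iKeptTail iKeptHead (Const 0) xpred0 s isT st isT isT (fun _ _ _ _ _ => erefl).
    by move=> c; rewrite /s0 r0 !inE.
  by move=> a; rewrite inE.
move=> i s1; have [-> _] := st0 => lti vi fr [K [CH [last [pk rC kK kl]]]].
pose v := Ordinal lti; rewrite 2!den_seq; set s2 := den (PWrite aLast _ _) _.
have fr2 a j : a \notin [:: aKept; aLast] -> s2 a j = s1 a j.
  by rewrite !inE negb_or => /andP[? ?]; rewrite /s2 !frame ?inE.
have frs a j : a \notin [:: aKept; aLast; aChain; vTwins; vRep; fDiffer; iVert; iTwin; iNbr;
  iKeptTail; iKeptHead] -> s2 a j = s a j.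
  move=> na; rewrite fr2 ?fr /s0 ?frame //; exact: notin_sub na.
have st2 : std n s2 by apply: std_eq st => j; rewrite frs.
have rE2 : repr s2 aAdj E by apply: repr_eq rE => j; rewrite frs.
have ms2 u : s2 aNonsink u = (u \notin snk E) by rewrite frs.
have v2 : s2 iVert 0 = v by rewrite fr2.
have rC2 : repr s2 aChain CH by apply: repr_eq rC => j; rewrite fr2.
have e30 j : s2 aKept j = if j == v then 1 else s1 aKept j.
  by rewrite /s2 frame // den_write update_eq /= vi.
have e31 j : s2 aLast j = if j == v then v : nat else s1 aLast j.
  by rewrite /s2 !den_write update_eq /= !update_neq // vi.
have [rem _ laK _ _ _ pre] := pk.
have vK : v \notin K by apply/negP=> /pre; rewrite ltnn.
have Kv u : u \in K -> (val u == v) = false by move=> /pre; apply: ltn_eqF.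
have kK2 u : u < v -> s2 aKept u = (u \in K) by move=> ltu; rewrite e30 ltn_eqF // kK.
have [cnt rep] := scan_twins_spec st2 rE2 ms2 kK2 pre v2.
rewrite den_seq; set s3 := den scan_twins s2 in cnt rep *.
have fr3 a j : a \notin mods scan_twins -> s3 a j = s2 a j by apply: frame.
have h3 : s3 vQuota 0 = h by rewrite fr3 // frs.
rewrite den_if eval_not /= h3 cnt subn_eq0; case: leqP => [many|few].
  have [r [r36 rT rmax]] := rep (leq_trans h0 many).
  have rK : r \in K by move: rT; rewrite inE => /andP[].
  have v3 : s3 iVert 0 = v by rewrite fr3.
  rewrite 2!den_seq !den_write /=.
  pose last' a := if a == r then v else last a.
  exists K, ((last r, v) |: CH), last'; split.
  - exact: (@partial_kernel_drop v r K CH last last' pk many rT rmax).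
  - apply: (@repr_eq n (update s3 aChain (cell (last r, v)) true)).
      have r31 : s3 aLast r = last r by rewrite fr3 // e31 Kv // kl.
      have row : s3 aRow (last r) = last r * n by have [_ row] := st2; rewrite fr3.
      by move=> j; rewrite update_neq // !update_eq !update_neq // r36 r31 row v3.
    apply: (repr_update (P := CH)); first by move=> c; rewrite !inE; case: eqP.
    by apply: repr_eq rC2 => j; rewrite fr3.
  - move=> u leu; rewrite update_neq // update_neq // update_eq v3 fr3 // e30.
    case: eqP => [/val_inj->|/eqP nuv]; first by rewrite (negbTE vK).
    by rewrite kK //; move: leu; rewrite ltnS leq_eqVlt (negbTE nuv).
  move=> a aK; rewrite update_eq !update_neq // r36 v3 fr3 // e31 Kv // kl //.
  by rewrite /last' -val_eqE; case: eqP.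
pose last' a := if a == v then v else last a.
have lK a : a \in K -> last' a = last a.
  by move=> aK; rewrite /last' -val_eqE Kv.
change (den PSkip s3) with s3; exists (v |: K), CH, last'; split.
- by apply: (@partial_kernel_keep v K CH last last' pk few) => //; rewrite /last' eqxx.
- by apply: repr_eq rC2 => j; rewrite fr3.
- move=> u leu; rewrite fr3 // e30 in_setU1 -val_eqE /=.
  case: eqP => //= /eqP nuv; rewrite kK //; move: leu; rewrite ltnS leq_eqVlt.
  by case/orP=> // /eqP uv; rewrite uv eqxx in nuv.
move=> a /setU1P[->|aK]; rewrite fr3 // e31 ?eqxx ?Kv //.
  by rewrite /last' eqxx.
by rewrite lK // kl.
Qed.

End KernelSteps.

(** * Enumeration of the arc sets between kept vertices *)

Definition count_subsets :=
  PFill aSubset iKeptTail iKeptHead (Const 0);; PWrite vSubsets (Const 0) (Const 1);;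
  PFor2 iKeptTail iKeptHead (PIf (eand (Read aKept (var iKeptTail)) (Read aKept (var iKeptHead)))
    (PWrite vSubsets (Const 0) (Add (var vSubsets) (var vSubsets))) PSkip).

Definition lift_candidate :=
  PFill aCand iKeptTail iKeptHead (ent aChain iKeptTail iKeptHead);;
  PFor2 iKeptTail iKeptHead (PIf (ent aSubset iKeptTail iKeptHead)
    (PWrite aCand (Add (Read aRow (Read aLast (var iKeptTail))) (var iKeptHead)) (Const 1)) PSkip).

(* Only the bits of the pairs of kept vertices take part in the counter. *)
Definition increment :=
  PWrite fCarry (Const 0) (Const 1);;
  PFor2 iKeptTail iKeptHead (PIf (eand (var fCarry) (eand (Read aKept (var iKeptTail))
    (Read aKept (var iKeptHead))))
    (PIf (ent aSubset iKeptTail iKeptHead) (PWrite aSubset (ecell iKeptTail iKeptHead) (Const 0))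
      (PWrite aSubset (ecell iKeptTail iKeptHead) (Const 1);; PWrite fCarry (Const 0)
        (Const 0))) PSkip).

Definition search_body := lift_candidate;; consider;; increment.
Definition search := PFor iSubset vSubsets search_body.

Section Enumeration.

Variables (n : nat) (K : {set 'I_n}).
Implicit Types (P Q : {set 'I_n * 'I_n}) (c : 'I_n * 'I_n) (s : store).

(** The counter is spread over the cells of a matrix of which only the pairs of kept vertices are
    bits; [rank] is the position of a bit among these, and [value] the binary number that the matrix
    stands for. *)
Definition rank q := #|[set c in within K | cell c < q]|.
Definition partial_value q P := \sum_(c in P | cell c < q) 2 ^ rank (cell c).
Definition value P := partial_value (n * n) P.

Lemma rank_full : rank (n * n) = #|K| ^ 2.
Proof.
rewrite -mulnn -cardsX; apply: eq_card => c.
by rewrite !inE cell_lt andbT.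
Qed.

Lemma rankS c : rank (cell c).+1 = (c \in within K) + rank (cell c).
Proof.
rewrite /rank (cardsD1 c) [c \in [set _ in _ | _]]inE ltnSn andbT; congr (_ + _).
by apply: eq_card => d; rewrite !inE cell_ltS; case: eqP => [->|] //=; rewrite ltnn !andbF.
Qed.

Lemma rank_gap q : (forall c, cell c <> q) -> rank q.+1 = rank q.
Proof.
move=> nq; apply: eq_card => c; rewrite !inE ltnS leq_eqVlt.
by have /eqP/negbTE-> := nq c.
Qed.

Lemma partial_valueS c P :
  partial_value (cell c).+1 P = (c \in P) * 2 ^ rank (cell c) + partial_value (cell c) P.
Proof.
rewrite /partial_value; case: (boolP (c \in P)) => cP.
  rewrite (bigD1 c) /= ?cP ?leqnn //= mul1n; congr (_ + _); apply: eq_bigl => d.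
  by rewrite cell_ltS; case: eqP => [->|] /=; rewrite ?ltnn ?andbF ?andbT.
rewrite mul0n; apply: eq_bigl => d; rewrite cell_ltS; case: eqP => [->|] //=.
by rewrite (negbTE cP).
Qed.

Lemma partial_value_gap q P : (forall c, cell c <> q) -> partial_value q.+1 P = partial_value q P.
Proof.
move=> nq; apply: eq_bigl => c; rewrite ltnS leq_eqVlt.
by have /eqP/negbTE-> := nq c.
Qed.

(** Lets inductions over [q] step past numbers that are no cells, without dividing by [n]. *)
Lemma cell_cases q : (exists c : 'I_n * 'I_n, cell c = q) \/ (forall c : 'I_n * 'I_n, cell c <> q).
Proof.
case: (pickP (fun c : 'I_n * 'I_n => cell c == q)) => [c /eqP|nc]; first by left; exists c.
by right=> c /eqP; rewrite nc.
Qed.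

Lemma partial_value_lt q P : P \subset within K -> partial_value q P < 2 ^ rank q.
Proof.
move=> PK; elim: q => [|q IHq].
  by rewrite /partial_value big_pred0 ?expn_gt0 // => c; rewrite andbF.
have [[c cq]|nq] := cell_cases q; last by rewrite partial_value_gap // rank_gap.
rewrite -cq partial_valueS rankS expnD cq; case: (boolP (c \in P)) => [/(subsetP PK)->|_].
  by rewrite expn1 mul1n mul2n -addnn ltn_add2l.
apply: leq_trans IHq _; rewrite -[leqLHS]mul1n leq_mul2r orbC; case: (_ \in _) => //.
Qed.

(** Uniqueness of binary expansions: the parts below the top bit are smaller than its weight, so the
    top bits agree and then so do the rest. *)
Lemma partial_value_inj q P Q : P \subset within K -> Q \subset within K ->
  partial_value q P = partial_value q Q -> forall c, cell c < q -> (c \in P) = (c \in Q).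
Proof.
move=> PK QK; elim: q => // q IHq; have [[c cq]|nq] := cell_cases q; last first.
  rewrite !partial_value_gap // => /IHq eq c; rewrite ltnS leq_eqVlt.
  by have /eqP/negbTE-> := nq c; apply: eq.
have lP := partial_value_lt q PK; have lQ := partial_value_lt q QK.
rewrite -{1 2}cq !partial_valueS cq => eq.
have [eqc eqv] : (c \in P) = (c \in Q) /\ partial_value q P = partial_value q Q.
  by case: (c \in P) (c \in Q) eq => [] []; split; lia.
move=> d; rewrite -cq cell_ltS => /predU1P[->//|]; rewrite cq; exact: IHq.
Qed.

Lemma value_inj P Q : P \subset within K -> Q \subset within K ->
  value P = value Q -> P = Q.
Proof.
move=> PK QK eq; apply/setP=> c; exact: (partial_value_inj PK QK eq (cell_lt c)).
Qed.

Lemma value_lt P : P \subset within K -> value P < 2 ^ (#|K| ^ 2).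
Proof. by move=> PK; rewrite -rank_full; apply: partial_value_lt. Qed.

Lemma value_add1 c P : c \notin P -> value (c |: P) = 2 ^ rank (cell c) + value P.
Proof.
move=> cP; rewrite /value /partial_value.
rewrite (eq_bigl (mem (c |: P))) => [|d]; last by rewrite cell_lt andbT.
rewrite [in RHS](eq_bigl (mem P)) => [|d]; last by rewrite cell_lt andbT.
by rewrite big_setU1.
Qed.

Definition marked s := forall u : 'I_n, s aKept u = (u \in K).

Lemma marked_eq s s' : (forall j, s' aKept j = s aKept j) -> marked s -> marked s'.
Proof. by move=> eq m u; rewrite eq. Qed.

Lemma eval_marked s x y c : marked s -> s x 0 = c.1 -> s y 0 = c.2 ->
  (eval s (eand (Read aKept (var x)) (Read aKept (var y))) != 0) = (c \in within K).
Proof.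
by move=> m xc yc; rewrite eval_and /= xc yc !m inE; case: (_ \in K); case: (_ \in K).
Qed.

(** The number of candidates is obtained by one doubling per pair of kept vertices, since the
    machine only adds. *)
Lemma count_subsets_spec s : std n s -> marked s ->
  repr (den count_subsets s) aSubset (set0 : {set 'I_n * 'I_n}) /\
  den count_subsets s vSubsets 0 = 2 ^ (#|K| ^ 2).
Proof.
move=> st ms; rewrite /count_subsets 2!den_seq; set fill := PFill _ _ _ _.
set s1 := den _ (den fill s); set loop := PFor2 _ _ _.
have r0 : repr (den fill s) aSubset (set0 : {set 'I_n * 'I_n}).
  have r0 := @fill_spec n aSubset iKeptTail iKeptHead (Const 0) xpred0 s isT st isT isT (fun _ _ _ _ _ => erefl).
  by move=> c; rewrite r0 !inE.
split; first by apply: repr_eq r0 => j; rewrite frame // /s1 frame.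
have ms1 : marked s1 by apply: marked_eq ms => j; rewrite /s1 !frame.
pose I q (s' : store) := s' vSubsets 0 = 2 ^ rank q.
suff : I (n * n) (den loop s1) by rewrite /I rank_full.
apply: (@for2_ind n I) => //.
- by rewrite /s1 !frame //; have [] := st.
- have -> : I 0 s1 = (s1 vSubsets 0 = 2 ^ rank 0) by [].
  by rewrite /rank eq_card0 // => c; rewrite inE andbF.
move=> c s2 xc yc fr; rewrite /I => IH; rewrite den_if (@eval_marked _ iKeptTail iKeptHead c) //;
  last first.
  by apply: marked_eq ms1 => j; rewrite fr.
rewrite rankS; case: ifP => _; last by rewrite add0n.
by rewrite den_write update_eq eqxx /= IH expnS mul2n addnn.
Qed.

Lemma lift_candidate_spec s P CH (last : 'I_n -> 'I_n) : std n s -> repr s aChain CH ->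
  repr s aSubset P ->
  P \subset within K -> {in K, forall a : 'I_n, s aLast a = last a} ->
  repr (den lift_candidate s) aCand (lift CH last P).
Proof.
move=> st rC rP PK la; rewrite /lift_candidate den_seq; set fill := PFill _ _ _ _.
have r1 : repr (den fill s) aCand CH.
  apply: repr_ext (@fill_spec n aCand iKeptTail iKeptHead _ (fun c => c \in CH) s isT st isT isT _).
    by move=> c; rewrite inE.
  move=> c s' xc yc fr; have st' : std n s' by apply: std_eq st => j; rewrite fr.
  by apply: (eval_ent st' xc yc); apply: repr_eq rC => j; rewrite fr.
have st1 : std n (den fill s) by apply: std_frame st.
pose upto q := CH :|: [set (last c.1, c.2) | c in P & cell c < q].
pose I q s' := repr s' aCand (upto q).
suff : I (n * n) (den (PFor2 iKeptTail iKeptHead (PIf (ent aSubset iKeptTail iKeptHead)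
    (PWrite aCand (Add (Read aRow (Read aLast (var iKeptTail))) (var iKeptHead))
      (Const 1)) PSkip)) (den fill s)).
  apply: repr_ext => c; rewrite /upto /lift; congr (_ \in _ :|: _).
  by apply/setP=> e; apply/imsetP/imsetP=> -[d dP ->]; exists d; move: dP;
    rewrite // inE cell_lt andbT.
apply: (@for2_ind n I) => //; first by have [] := st1.
  apply: repr_ext r1 => c; rewrite inE; case: imsetP => [[d]|]; rewrite ?orbF //.
  by rewrite inE andbF.
move=> c s2 xc yc fr IH; have st2 : std n s2 by apply: std_eq st1 => j; rewrite fr.
have rP2 : repr s2 aSubset P by apply: repr_eq rP => j; rewrite fr // frame.
have uptoS d : (d \in upto (cell c).+1) =
    if (c \in P) && (d == (last c.1, c.2)) then true else d \in upto (cell c).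
  rewrite /upto !in_setU; apply/orP/idP => [[->|]|].
  - by rewrite orTb if_same.
  - case/imsetP=> e; rewrite inE cell_ltS => /andP[eP /predU1P[ec|lte]] ->.
      by rewrite -ec eP eqxx.
    rewrite [X in _ || X]imset_f ?orbT ?if_same //.
    by rewrite inE eP.
  case: ifP => [/andP[cP /eqP->] _|_ /orP[->|/imsetP[e]]]; [right | by left | ].
    by apply/imsetP; exists c; rewrite // inE cP leqnn.
  rewrite inE => /andP[eP lte] ->; right; apply/imsetP; exists e => //.
  by rewrite inE eP cell_ltS lte orbT.
rewrite den_if (eval_ent st2 xc yc rP2); case: ifP => cP; last first.
  by apply: repr_ext IH => d; rewrite uptoS cP.
have c1K : c.1 \in K by have:= subsetP PK _ cP; rewrite inE => /andP[].
have c31 : s2 aLast c.1 = last c.1 by rewrite fr // frame // la.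
rewrite den_write /= xc yc c31; have [_ ->] := st2; rewrite -/(cell (last c.1, c.2));
  apply: (repr_update (b := true) _ IH).
by move=> d; rewrite uptoS cP.
Qed.

(** [b] is the carry. Throughout the scan, the value of the array plus the carry at the weight of
    the next bit equals the successor of the old value; a final carry signals overflow. *)
Lemma increment_spec s P : std n s -> repr s aSubset P -> P \subset within K -> marked s ->
  exists Q (b : bool), [/\ repr (den increment s) aSubset Q, Q \subset within K
    & value Q + b * 2 ^ (#|K| ^ 2) = (value P).+1].
Proof.
move=> st rP PK ms; rewrite /increment den_seq den_write; set s1 := update _ _ _ _.
set loop := PFor2 _ _ _.
pose I q (s' : store) := exists Q (b : bool), [/\ repr s' aSubset Q, s' fCarry 0 = b,
  Q \subset within K
  & value Q + b * 2 ^ rank q = (value P).+1].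
suff : I (n * n) (den loop s1).
  by move=> [Q [b [rQ _ QK val]]]; exists Q, b; rewrite -rank_full.
have st1 : std n s1 by apply: std_eq st => j; rewrite /s1 update_neq.
apply: (@for2_ind n I) => //; first by have [] := st1.
  exists P, true; split=> //; rewrite /rank eq_card0 ?addn1 // => c; by rewrite inE andbF.
move=> c s2 xc yc fr [Q [b [rQ cb QK val]]].
have st2 : std n s2 by apply: std_eq st1 => j; rewrite fr.
have ms2 : marked s2 by apply: marked_eq ms => j; rewrite fr // /s1 update_neq.
rewrite den_if eval_and (@eval_marked _ iKeptTail iKeptHead c) //= cb.
case: b cb val => /= [cb val|cb val]; last first.
  by exists Q, false; split.
case: ifP => cK; last by exists Q, true; split=> //; rewrite rankS cK.
rewrite den_if (eval_ent st2 xc yc rQ) !den_seq !den_write (@eval_cell n s2 iKeptTail iKeptHead c.1 c.2) //.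
rewrite -(surjective_pairing c); case: (boolP (c \in Q)) => cQ.
  exists (Q :\ c), true; split=> //.
  - apply: (repr_update (b := false) _ rQ) => d; rewrite !inE.
    by case: eqP => [->|]; rewrite ?andbF.
  - by apply: subset_trans QK; apply: subsetDl.
  rewrite -val rankS cK expnS -[in RHS](setD1K cQ) value_add1; last by rewrite !inE eqxx.
  by rewrite !mul1n mul2n -addnn addnA [value _ + _]addnC.
exists (c |: Q), false; split.
- apply: (@repr_eq n (update s2 aSubset (cell c) true)); first by move=> j; rewrite update_neq.
  by apply: (repr_update _ rQ) => d; rewrite !inE; case: eqP.
- by rewrite update_eq.
- by rewrite subUset sub1set cK.
by rewrite -val value_add1 // addn0 addnC mul1n.
Qed.

Lemma search_spec B (E CH : {set 'I_n * 'I_n}) (last : 'I_n -> 'I_n) s : std n s -> repr s aAdj E ->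
  best B E s -> marked s -> repr s aChain CH -> repr s aSubset (set0 : {set 'I_n * 'I_n}) ->
  {in K, forall a : 'I_n, s aLast a = last a} -> s vSubsets 0 = 2 ^ (#|K| ^ 2) ->
  [/\ best B E (den search s), s vBest 0 <= den search s vBest 0
    & forall P, P \subset within K -> feasible E B (lift CH last P) ->
        connectivity (E :|: lift CH last P) <= den search s vBest 0].
Proof.
move=> st rE bs ms rC r0 la s34.
pose I w (s' : store) := [/\ best B E s', s vBest 0 <= s' vBest 0,
  (* The value is asserted only below the number of subsets, because the counter overflows in the
     last round. *)
  exists Q, [/\ repr s' aSubset Q, Q \subset within K & w < 2 ^ (#|K| ^ 2) -> value Q = w]
  & forall P, P \subset within K -> value P < w -> feasible E B (lift CH last P) ->
        connectivity (E :|: lift CH last P) <= s' vBest 0].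
have : I (s vSubsets 0) (den search s); last first.
  case=> bs' mono _ all; split=> // P PK; apply: all => //; rewrite s34; exact: value_lt.
apply: (@for_ind I) => //.
  split=> //; exists set0; split; rewrite ?sub0set // => _.
  by rewrite /value /partial_value big_pred0 // => c; rewrite inE.
move=> w s1; rewrite s34 => ltw _ fr [bs1 mono [Q [rQ QK valQ]] all].
have {}valQ := valQ ltw.
have st1 : std n s1 by apply: std_eq st => j; rewrite fr.
have rE1 : repr s1 aAdj E by apply: repr_eq rE => j; rewrite fr.
have rC1 : repr s1 aChain CH by apply: repr_eq rC => j; rewrite fr.
have ms1 : marked s1 by apply: marked_eq ms => j; rewrite fr.
have la1 : {in K, forall a : 'I_n, s1 aLast a = last a} by move=> a aK; rewrite fr // la.
have rL := lift_candidate_spec st1 rC1 rQ QK la1.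
rewrite /search_body 2!den_seq.
have fr2 a j : a \notin mods lift_candidate -> den lift_candidate s1 a j = s1 a j by apply: frame.
move: (den lift_candidate s1) fr2 rL => s2 fr2 rL.
have st2 : std n s2 by apply: std_eq st1 => j; rewrite fr2.
have rE2 : repr s2 aAdj E by apply: repr_eq rE1 => j; rewrite fr2.
have bs2 : best B E s2.
  by apply: best_eq bs1 => a j; rewrite !inE => /or3P[]/eqP->; rewrite fr2.
have [bs3 mono3 opt3] := consider_spec st2 rE2 rL bs2.
have fr3 a j : a \notin mods consider -> den consider s2 a j = s2 a j by apply: frame.
move: (den consider s2) fr3 bs3 mono3 opt3 => s3 fr3 bs3 mono3 opt3.
have st3 : std n s3 by apply: std_eq st2 => j; rewrite fr3.
have rQ3 : repr s3 aSubset Q by apply: repr_eq rQ => j; rewrite fr3 // fr2.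
have ms3 : marked s3 by apply: marked_eq ms1 => j; rewrite fr3 // fr2.
have [Q' [b [rQ' QK' val']]] := increment_spec st3 rQ3 QK ms3.
have e6 : den increment s3 vBest 0 = s3 vBest 0 by rewrite frame.
rewrite fr2 // in mono3; split; rewrite ?e6.
- by apply: best_frame.
- exact: leq_trans mono mono3.
- exists Q'; split=> // ltw'; move: val'; rewrite valQ; case: b => /=; last by rewrite addn0.
  by move=> eq; move: ltw'; rewrite -eq mul1n ltnNge leq_addl.
move=> P PK; rewrite ltnS leq_eqVlt => /predU1P[eqP|ltP] fP.
  have PQ : P = Q by apply: value_inj; rewrite // valQ.
  by move: opt3; rewrite -PQ; apply.
by apply: leq_trans mono3; apply: all.
Qed.

End Enumeration.

(** * The complete algorithm *)

Definition init_rows :=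
  PFor iVert 0 (PWrite aRow (Add (var iVert) (Const 1)) (Add (Read aRow (var iVert)) (var 0))).

Definition six_times e := Add e (Add e (Add e (Add e (Add e e)))).

(* With too many non-sinks [vSubsets] is set to 0, which makes [search] void. *)
Definition prepare :=
  mark_nonsinks;; PWrite vParam (Const 0) (Sub (var 0) (Read 0 (Const 1)));;
  PWrite vQuota (Const 0) (six_times (var vParam));;
  PIf (Sub (var vParam) (var vNonsinks)) (build_kernel;; count_subsets)
    (PWrite vSubsets (Const 0) (Const 0)).

Definition transpose_array a :=
  PFill aTemp iKeptTail iKeptHead (ent a iKeptHead iKeptTail);;
    PFill a iKeptTail iKeptHead (ent aTemp iKeptTail iKeptHead).

(** The second phase reverses the graph along with the stored solution, which preserves [best]; the
    third reverses the solution back. The searches stand apart because their bound [vSubsets] is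
    written by [prepare]: their cost has to be read off the store in which each of them starts. *)
Definition phase1 := init_rows;; augment;; consider;; prepare.
Definition phase2 := transpose_array aAdj;; transpose_array aBest;; prepare.
Definition phase3 := transpose_array aBest.
Definition main := phase1;; search;; phase2;; search;; phase3.

(** The sets of pairs within a kernel of at most k + 2^k * 6k vertices. *)
Definition work k := 2 ^ ((k + 2 ^ k * (6 * k)) ^ 2).

Lemma init_rows_spec n s : s 0 0 = n -> s aRow 0 = 0 -> std n (den init_rows s).
Proof.
move=> n0 r0; split=> [|i]; first by rewrite frame.
pose I i (s' : store) := forall j, j <= i -> s' aRow j = j * n.
suff : I (s 0 0) (den init_rows s) by apply; rewrite n0 ltnW.
apply: (@for_ind I) => //; first by move=> j; rewrite leqn0 => /eqP->.
move=> {}i s' lti xi fr IH j; rewrite den_write update_eq /= xi addn1 leq_eqVlt.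
case: eqP => [->|_ ltj]; last exact: IH.
by rewrite IH // fr // n0 mulSn addnC.
Qed.

Lemma transpose_array_spec n s a (P : {set 'I_n * 'I_n}) :
  a \notin [:: 0; aRow; iKeptTail; iKeptHead; aTemp] -> std n s -> repr s a P ->
  repr (den (transpose_array a) s) a (transpose P).
Proof.
rewrite !inE !negb_or => /and5P[a0 a3 a43 a44 a45] st rP; rewrite /transpose_array den_seq.
set p := PFill aTemp _ _ _.
have r45 : repr (den p s) aTemp (transpose P).
  apply: repr_ext (@fill_spec n aTemp iKeptTail iKeptHead _ (fun c => (c.2,
    c.1) \in P) s isT st isT isT _).
    by move=> c; rewrite !inE.
  move=> c s' xc yc fr; have st' : std n s' by apply: std_eq st => j; rewrite fr.
  apply: (eval_ent (c := (c.2, c.1)) st' yc xc); apply: repr_eq rP => j.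
  by rewrite fr // !inE !negb_or a43 a44.
have st1 : std n (den p s) by apply: std_frame st.
apply: repr_ext (@fill_spec n a iKeptTail iKeptHead _ (fun c => c \in transpose P)
  (den p s) _ st1 _ isT _).
- by move=> c; rewrite inE.
- by rewrite /= !inE !negb_or !(eq_sym _ a) a0 a43 a44.
- by rewrite !inE !negb_or a0 a3 a43.
move=> c s' xc yc fr.
have st' : std n s'.
  by apply: std_eq st1 => j; rewrite fr // !inE !negb_or /= eq_sym.
apply: (eval_ent st' xc yc); apply: repr_eq r45 => j.
by rewrite fr // !inE /= eq_sym.
Qed.

Lemma prepare_search_spec n B (E : {set 'I_n * 'I_n}) s : acyclic E -> std n s ->
  repr s aAdj E -> best B E s ->
  let s' := den search (den prepare s) in
  [/\ best B E s', s vBest 0 <= s' vBest 0, den prepare s vSubsets 0 <= work (n - B)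
    & #|~: snk E| < n - B -> forall N, feasible E B N -> connectivity (E :|: N) <= s' vBest 0].
Proof.
move=> acE st rE bs; rewrite /prepare 3!den_seq.
have [mk card] := mark_nonsinks_spec st rE.
have fr0 a j : a \notin mods mark_nonsinks -> den mark_nonsinks s a j = s a j by apply: frame.
move: (den mark_nonsinks s) fr0 mk card => s0 fr0 mk card.
set s1 := den _ (den _ s0); pose k := n - B.
have fr1 a j : a \notin [:: vQuota; vParam] -> s1 a j = s0 a j.
  by rewrite !inE negb_or => /andP[? ?]; rewrite /s1 !frame ?inE.
have [[n0 _] [B0 _]] := (st, bs).
have k1 : s1 vParam 0 = k by rewrite /s1 frame // den_write update_eq /= !fr0 // n0 B0.
have h1 : s1 vQuota 0 = 6 * k.
  by rewrite /s1 den_write update_eq /= den_write update_eq /= !fr0 // n0 B0 -/k; lia.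
have c1 : s1 vNonsinks 0 = #|~: snk E| by rewrite fr1.
have st1 : std n s1 by apply: std_eq st => j; rewrite fr1 // fr0.
have rE1 : repr s1 aAdj E by apply: repr_eq rE => j; rewrite fr1 // fr0.
have mk1 (u : 'I_n) : s1 aNonsink u = (u \notin snk E) by rewrite fr1.
have bs1 : best B E s1.
  by apply: best_eq bs => a j; rewrite !inE => /or3P[]/eqP->; rewrite fr1 // fr0.
have v1 : s1 vBest 0 = s vBest 0 by rewrite fr1 // fr0.
move: s1 fr1 k1 h1 c1 st1 rE1 mk1 bs1 v1 => s1 _ k1 h1 c1 st1 rE1 mk1 bs1 v1.
rewrite den_if /= k1 c1 subn_eq0 -ltnNge; case: ltnP => [few|_]; last first.
  rewrite !den_write /=; set s2 := update _ _ _ _.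
  have -> : den search s2 = update s2 iSubset 0 0 by [].
  by split=> //; rewrite -v1.
have h0 : 0 < 6 * k by lia.
have [K [CH [last [ker rC kK kl]]]] := build_kernel_spec h0 st1 rE1 mk1 h1.
rewrite den_seq.
have fr2 a j : a \notin mods build_kernel -> den build_kernel s1 a j = s1 a j by apply: frame.
move: (den build_kernel s1) fr2 rC kK kl => s2 fr2 rC kK kl.
have st2 : std n s2 by apply: std_eq st1 => j; rewrite fr2.
have [r0 W] := count_subsets_spec st2 (kK : marked K s2).
have fr3 a j : a \notin mods count_subsets -> den count_subsets s2 a j = s2 a j by apply: frame.
move: (den count_subsets s2) fr3 r0 W => s3 fr3 r0 W.
have st3 : std n s3 by apply: std_eq st2 => j; rewrite fr3.
have rE3 : repr s3 aAdj E by apply: repr_eq rE1 => j; rewrite fr3 // fr2.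
have rC3 : repr s3 aChain CH by apply: repr_eq rC => j; rewrite fr3.
have kK3 : marked K s3 by move=> u; rewrite fr3.
have kl3 : {in K, forall a : 'I_n, s3 aLast a = last a} by move=> a aK; rewrite fr3 // kl.
have bs3 : best B E s3.
  by apply: best_eq bs1 => a j; rewrite !inE => /or3P[]/eqP->; rewrite fr3 // fr2.
have [bs4 mono all] := search_spec st3 rE3 bs3 kK3 rC3 r0 kl3 W.
split=> //.
- by rewrite -v1; apply: leq_trans mono; rewrite fr3 // fr2.
- rewrite W /work leq_exp2l // leq_exp2r //; apply: leq_trans (kernel_size ker) _.
  by apply: leq_add; rewrite ?leq_mul2r ?leq_pexp2l ?(ltnW few) ?orbT.
move=> _ N fN; have [N' [N'K fN' max]] := kernel_optimal acE (erefl k) few ker.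
exact: leq_trans (max N fN) (all _ N'K fN').
Qed.

Section Main.

Variable x : mci_instance.
Let n := nverts x.
Let B := budget x.
Let E := arcs x.
Let s0 := mci_encode x.
Let s1 := den phase1 s0.
Let s2 := den phase2 (den search s1).

Lemma main_spec : [/\ s1 vSubsets 0 <= work (n - B), s2 vSubsets 0 <= work (n - B)
  & mci_solved x (den main s0)].
Proof.
have acE : acyclic E := @arcs_acyclic x.
rewrite /main (den_seq phase1) (den_seq search) (den_seq phase2) (den_seq search).
rewrite /s2 /s1 /phase1 (den_seq init_rows) (den_seq augment) (den_seq consider).
have std1 : std n (den init_rows s0) by apply: init_rows_spec.
have fr1 a j : a != 3 -> a != iVert -> den init_rows s0 a j = s0 a j.
  by move=> a3 a38; rewrite frame // !inE negb_or a38.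
have rE1 : repr (den init_rows s0) aAdj E.
  move=> p; rewrite fr1 // /s0 /=; congr nat_of_bool.
  apply/existsP/idP=> [[q /andP[qE /eqP/cell_inj<-]]//|pE].
  by exists p; rewrite pE eqxx.
have bs1 : best B E (den init_rows s0).
  split; first by rewrite fr1.
  exists set0; split; rewrite ?fr1 //; last by rewrite /feasible sub0set cards0.
  by move=> p; rewrite fr1 // inE.
move: (den init_rows s0) std1 rE1 bs1 => t1 {fr1} st1 rE1 bs1.
have [M [rM connM fM]] := augment_spec B acE st1 rE1.
have fr2 a j : a \notin mods augment -> den augment t1 a j = t1 a j by apply: frame.
move: (den augment t1) fr2 rM => t2 fr2 rM.
have st2 : std n t2 by apply: std_eq st1 => j; rewrite fr2.
have rE2 : repr t2 aAdj E by apply: repr_eq rE1 => j; rewrite fr2.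
have bs2 : best B E t2.
  by apply: best_eq bs1 => a j; rewrite !inE => /or3P[]/eqP->; rewrite fr2.
have [bs3 _ opt3] := consider_spec st2 rE2 rM bs2.
have st3 := @std_frame n consider t2 isT isT st2.
have rE3 := @repr_frame n consider t2 aAdj E isT rE2.
move: (den consider t2) bs3 opt3 st3 rE3 => t3 bs3 opt3 st3 rE3.
have [bs4 mono4 work4 all4] := prepare_search_spec acE st3 rE3 bs3.
have st4 : std n (den search (den prepare t3)) by do 2!apply: std_frame => //.
have rE4 : repr (den search (den prepare t3)) aAdj E by do 2!apply: repr_frame => //.
move: (den prepare t3) work4 bs4 mono4 all4 st4 rE4 => t4' work4.
move: (den search t4') => t4 bs4 mono4 all4 st4 rE4.
rewrite /phase2 (den_seq (transpose_array aAdj)) (den_seq (transpose_array aBest)).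
have [B4 [N4 [rN4 fN4 le4]]] := bs4.
have rE5 := transpose_array_spec (a := aAdj) isT st4 rE4.
have st5 := @std_frame n (transpose_array aAdj) t4 isT isT st4.
have rN5 := @repr_frame n (transpose_array aAdj) t4 aBest N4 isT rN4.
have rN6 := transpose_array_spec (a := aBest) isT st5 rN5.
have st6 := @std_frame n (transpose_array aBest) _ isT isT st5.
have rE6 := @repr_frame n (transpose_array aBest) _ aAdj _ isT rE5.
have bs6 : best B (transpose E) (den (transpose_array aBest) (den (transpose_array aAdj) t4)).
  split; first by rewrite !frame.
  exists (transpose N4); split; rewrite ?feasible_transpose //.
  by rewrite -transposeU connectivity_transpose !frame.
have v6 : den (transpose_array aBest) (den (transpose_array aAdj) t4) vBest 0 = t4 vBest 0.
  by rewrite !frame.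
move: (den (transpose_array aBest) _) st6 rE6 bs6 v6 => t6 st6 rE6 bs6 v6.
have [bs7 mono7 work7 all7] := prepare_search_spec (acyclic_transpose acE) st6 rE6 bs6.
have st7 : std n (den search (den prepare t6)) by do 2!apply: std_frame => //.
move: (den prepare t6) work7 bs7 mono7 all7 st7 => t7' work7.
move: (den search t7') => t7 bs7 mono7 all7 st7; split=> //.
have [_ [N [rN fN leN]]] := bs7; exists (transpose N).
  split; first by rewrite -/E -feasible_transpose transposeK.
  rewrite -/n -/B -/E => N' fN2.
  have fN' : feasible (transpose E) B (transpose N') by rewrite feasible_transpose.
  have conn_tr P : connectivity (E :|: P) = connectivity (transpose E :|: transpose P).
    by rewrite -transposeU connectivity_transpose.
  rewrite !conn_tr transposeK; apply: leq_trans leN.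
  have few (S : {set 'I_n}) : B < #|S| -> #|~: S| < n - B.
    move=> lt; have := cardsC S; rewrite card_ord; lia.
  (* More than [B] sinks: the first search is exhaustive. More than [B] sources: the second one is.
     Otherwise the augmentation is within the budget and connects all pairs. *)
  have [csnk|/few/all4 all] := leqP #|sinks E setT| B; last first.
    by rewrite -conn_tr; apply: leq_trans mono7; rewrite v6; apply: all.
  have [csrc|] := leqP #|sources E setT| B; last first.
    rewrite -{1}[E]transposeK sources_transpose => /few/all7; exact.
  rewrite -conn_tr; apply: leq_trans mono7; rewrite v6; apply: leq_trans mono4.
  by apply: leq_trans (opt3 (fM csrc csnk)); apply: sub_connectivity => u v _; apply: connM.
exact: transpose_array_spec.
Qed.

End Main.

(** * Computability of the bound and running time *)

Definition terminates p := forall s, exists t, exec (compile p) s t (den p s).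

Lemma exec_compile_seq p q s t1 s1 t2 s2 : exec (compile p) s t1 s1 ->
  exec (compile q) s1 t2 s2 -> exec (compile (p;; q)) s (t1 + t2) s2.
Proof. exact: exec_seq. Qed.

Lemma terminates_seq p q : terminates p -> terminates q -> terminates (p;; q).
Proof.
move=> tp tq s; have [t1 ex1] := tp s; have [t2 ex2] := tq (den p s).
by exists (t1 + t2); apply: exec_compile_seq ex1 ex2.
Qed.

Lemma terminates_flat p : wf p -> all [predC mods p] (bounds p) -> terminates p.
Proof.
move=> wp /allP fr s.
by have [//|//|t ex _] := @exec_compile p (fun b => s b 0) s wp; exists t.
Qed.

Definition PRepeat x b y e := PFor x b (PWrite y (Const 0) (Add (var y) e)).

Lemma den_double x b y s : wf (PRepeat x b y (var y)) -> x != y ->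
  den (PRepeat x b y (var y)) s y 0 = s y 0 * 2 ^ s b 0.
Proof.
move=> wp xy; pose I i (s' : store) := s' y 0 = s y 0 * 2 ^ i.
suff : I (s b 0) (den (PRepeat x b y (var y)) s) by [].
apply: (@for_ind I) => // [i s' v|| i s' _ _ _]; rewrite /I ?update_neq ?muln1 // => IH.
by rewrite den_write update_eq eqxx /= IH addnn -mul2n mulnCA -expnS.
Qed.

Lemma den_sum x b y z s : wf (PRepeat x b y (var z)) -> x != y -> x != z -> y != z ->
  den (PRepeat x b y (var z)) s y 0 = s y 0 + s b 0 * s z 0.
Proof.
move=> wp xy xz yz; pose I i (s' : store) := s' y 0 = s y 0 + i * s z 0.
suff : I (s b 0) (den (PRepeat x b y (var z)) s) by [].
apply: (@for_ind I) => // [i s' v|| i s' _ _ fr]; rewrite /I ?update_neq ?addn0 // => IH.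
rewrite den_write update_eq eqxx /= IH fr ?mulSn 1?addnAC ?addnA //.
by rewrite !inE negb_or ![z == _]eq_sym xz yz.
Qed.

(* Entry 0 of array 1 receives 2 ^ k, of 3 the quota 6 k, of 4 the bound on the number of
   kept vertices, of 6 its square, of 8 the number of candidates and of 11 the result;
   the split ensures that no piece writes the bounds of its own loops. *)
Definition work_prog1 :=
  PWrite 1 (Const 0) (Const 1);; PRepeat 2 0 1 (var 1);;
  PWrite 3 (Const 0) (six_times (var 0));; PWrite 4 (Const 0) (var 0).
Definition work_prog2 := PRepeat 5 1 4 (var 3).
Definition work_prog3 := PRepeat 7 4 6 (var 4);; PWrite 8 (Const 0) (Const 1).
Definition work_prog4 C :=
  PRepeat 9 6 8 (var 8);; PWrite 10 (Const 0) (Const C);;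
  PWrite 8 (Const 0) (Add (var 8) (Const 1)).
Definition work_prog5 := PRepeat 12 10 11 (var 8);; PWrite 0 (Const 0) (var 11).

Lemma computable_work C : computable (fun k => C * (work k).+1).
Proof.
exists (compile (work_prog1;; work_prog2;; work_prog3;; work_prog4 C;; work_prog5)) => k.
set p := (work_prog1;; _); have [|t ex] := (_ : terminates p) (nat_input k).
  by do 4!(apply: terminates_seq; first exact: terminates_flat); apply: terminates_flat.
exists t, (den p (nat_input k)); split=> //; rewrite /p.
rewrite (den_seq work_prog1) (den_seq work_prog2) (den_seq work_prog3) (den_seq (work_prog4 C)).
have k0 : nat_input k 0 0 = k by [].
set s1 := den work_prog1 _.
have v1 : s1 1 0 = 2 ^ k.
  rewrite /s1 /work_prog1 3!den_seq (@frame (PWrite 4 _ _)) // (@frame (PWrite 3 _ _)) //.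
  by rewrite den_double // den_write update_eq /= mul1n.
have v3 : s1 3 0 = 6 * k.
  rewrite /s1 /work_prog1 3!den_seq (@frame (PWrite 4 _ _)) // den_write update_eq /= !frame //.
  by rewrite k0; lia.
have v4 : s1 4 0 = k.
  by rewrite /s1 /work_prog1 3!den_seq den_write update_eq /= !frame.
have z1 a : a \in [:: 6; 11] -> s1 a 0 = 0.
  by rewrite !inE => /orP[]/eqP->; rewrite /s1 frame.
set s2 := den work_prog2 s1.
have v4' : s2 4 0 = k + 2 ^ k * (6 * k) by rewrite /s2 /work_prog2 den_sum // v1 v3 v4.
set s3 := den work_prog3 s2.
have v6 : s3 6 0 = (k + 2 ^ k * (6 * k)) ^ 2.
  rewrite /s3 /work_prog3 den_seq frame // den_sum // v4' mulnn.
  by rewrite [s2 6 0]frame // z1.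
have v8 : s3 8 0 = 1 by rewrite /s3 /work_prog3 den_seq den_write update_eq.
set s4 := den (work_prog4 C) s3.
have v10 : s4 10 0 = C.
  by rewrite /s4 /work_prog4 2!den_seq frame // den_write update_eq.
have v8' : s4 8 0 = (work k).+1.
  rewrite /s4 /work_prog4 2!den_seq den_write update_eq /= frame // den_double // v6 v8.
  by rewrite mul1n addn1.
rewrite /work_prog5 den_seq den_write update_eq /= den_sum // v10 v8'.
by rewrite [s4 11 0]frame // [s3 11 0]frame // [s2 11 0]frame // z1.
Qed.

Lemma polynomial_time p : wf p -> all (pred1 0) (bounds p) -> 0 \notin mods p ->
  exists C d, forall s, exists2 t, exec (compile p) s t (den p s) & t <= C * (s 0 0).+1 ^ d.
Proof.
move=> wp /allP b0 m0; have [C [d poly]] := cost_polynomial p; exists C, d => s.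
have [||t ex let_] := @exec_compile p (fun b => s b 0) s wp.
- by move=> b /b0/eqP->.
- by [].
exists t => //; apply: leq_trans let_ _; apply: poly => b /b0/eqP-> //.
Qed.

Lemma search_time : exists C d, forall s, exists2 t, exec (compile search) s t (den search s) &
  t <= C * (s vSubsets 0).+1 * (s 0 0).+1 ^ d.
Proof.
have [C [d poly]] := cost_polynomial search_body; exists (9 + (C + 12)), d => s.
have [//|||t ex let_] := @exec_compile search (fun b => s b 0) s.
- exact/allP.
- by [].
exists t => //; apply: leq_trans let_ _.
have /(_ (s 0 0)) cb := poly (fun b => s b 0); rewrite /=.
have {}cb : cost (fun b => s b 0) search_body <= C * (s 0 0).+1 ^ d.
  by apply: cb => b; have /allP b0 : all (pred1 0) (bounds search_body) by []; move=> /b0/eqP->.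
have pos : 0 < (s 0 0).+1 ^ d by rewrite expn_gt0.
rewrite -mulnA mulnDl leq_add ?leq_pmulr ?muln_gt0 // mulnCA leq_mul //.
by rewrite mulnDl leq_add ?leq_pmulr.
Qed.

Theorem theorem4 :
  fixed_parameter_tractable mci_encode mci_solved nverts mci_param.
Proof.
have [C1 [d1 time1]] := @polynomial_time phase1 isT isT isT.
have [C2 [d2 time2]] := @polynomial_time phase2 isT isT isT.
have [C3 [d3 time3]] := @polynomial_time phase3 isT isT isT.
have [C4 [d4 time4]] := search_time.
(* The constants of the five pieces add up. The sum of the four degrees dominates each of them, and
   the successor of [work] keeps the factor positive for pieces whose cost does not depend on the
   parameter. *)
exists (compile main), (fun k => (C1 + (C4 + (C2 + (C4 + C3)))) * (work k).+1), (d1 + d2 + d3 + d4).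
split; first exact: computable_work.
move=> x; have [w1 w2 sol] := main_spec x.
rewrite -/(mci_param x) in w1 w2; set W := (work _).+1.
set s0 := mci_encode x in w1 w2 sol *; set s1 := den phase1 s0 in w1 w2.
set s2 := den phase2 (den search s1) in w2.
have [t1 ex1 le1] := time1 s0; have [t2 ex2 le2] := time4 s1.
have [t3 ex3 le3] := time2 (den search s1); have [t4 ex4 le4] := time4 s2.
have [t5 ex5 le5] := time3 (den search s2).
exists (t1 + (t2 + (t3 + (t4 + t5)))), (den main s0); split; last exact: sol.
  rewrite /main (den_seq phase1) (den_seq search) (den_seq phase2) (den_seq search).
  apply: exec_compile_seq ex1 _; apply: exec_compile_seq ex2 _.
  apply: exec_compile_seq ex3 _; exact: exec_compile_seq ex4 ex5.
have n0 : s0 0 0 = nverts x by [].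
have n1 : s1 0 0 = nverts x by rewrite /s1 frame.
have n2 : den search s1 0 0 = nverts x by rewrite frame.
have n3 : s2 0 0 = nverts x by rewrite /s2 frame.
have n4 : den search s2 0 0 = nverts x by rewrite frame.
rewrite n0 in le1; rewrite n1 in le2; rewrite n2 in le3; rewrite n3 in le4; rewrite n4 in le5.
set m := (nverts x).+1 in le1 le2 le3 le4 le5 *; set d := d1 + _ + _ + _.
have mono C e : e <= d -> C * m ^ e <= C * W * m ^ d.
  move=> led; rewrite -mulnA leq_mul2l; apply/orP; right.
  by apply: leq_trans (leq_pexp2l _ led) (leq_pmull _ _).
have mono' C w : w <= work (mci_param x) -> C * w.+1 * m ^ d4 <= C * W * m ^ d.
  move=> lew; apply: leq_mul; first by rewrite leq_mul2l ltnS lew orbT.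
  by rewrite leq_pexp2l // /d; lia.
rewrite !mulnDl.
apply: leq_add; first by apply: leq_trans le1 (mono _ _ _); rewrite /d; lia.
apply: leq_add; first exact: leq_trans le2 (mono' _ _ w1).
apply: leq_add; first by apply: leq_trans le3 (mono _ _ _); rewrite /d; lia.
apply: leq_add; first exact: leq_trans le4 (mono' _ _ w2).
by apply: leq_trans le5 (mono _ _ _); rewrite /d; lia.
Qed.
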